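(* Let $X,Y,Z$ be locally convex Hausdorff topological vector spaces, $K\subset Y$ a proper closed convex cone with $\operatorname{int}K\neq\emptyset$, and $S\subset Z$ a nonempty convex cone. Let $\Phi\colon X\times Z\to Y^\infty$ be a $K$-convex mapping with $0_Z\in\pi(\operatorname{dom}\Phi)$, where $\pi(x,z)=z$, and let $Z_0=\operatorname{lin}(\pi(\operatorname{dom}\Phi))$ with the induced topology. For $(L,y)\in\mathcal L(X,Y)\times Y$ consider: $(\alpha)$ $\Phi(x,0_Z)-L(x)+y\notin-\operatorname{int}K$ for all $x\in X$; $(\beta)$ there exists $T\in\mathcal L_\Phi$ such that $\Phi(x,z)-L(x)-T(z)+y\notin-\operatorname{int}K$ for all $(x,z)\in X\times Z$; $(\gamma)$ there exists $T\in\mathcal L_\Phi^+$ such that $\Phi(x,z)-L(x)-T(z)+y\notin-\operatorname{int}K$ for all $(x,z)\in X\times Z$. (i) If $0_Z\in\pi(\operatorname{dom}\Phi)-\operatorname{int}S$ and $\Phi(x,0_Z)\leqq_K\Phi(x,z)$ whenever $(x,z)\in\operatorname{dom}\Phi$ and $z\in S$, then $(\alpha)\Leftrightarrow(\beta)$ for all $(L,y)\in\mathcal L(X,Y)\times Y$, and $(\alpha)\Leftrightarrow(\gamma)$ for all $(L,y)\in\mathcal L(X,Y)\times Y$. (ii) Suppose at least one of the following holds: (1) there exist $(\widehat x,\widehat y)\in X\times Y$ and a neighborhood $\widehat V$ of $0_Z$ such that $\Phi(\widehat x,z)\leqq_K\widehat y$ for all $z\in\widehat V\cap Z_0$; (2)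 there exists $\widehat x\in X$ such that the restriction of $\Phi(\widehat x,\cdot)$ to $Z_0$ is continuous at $0_Z$; (3) $\dim Z_0<\infty$ and $0_Z\in\operatorname{ri}(\pi(\operatorname{dom}\Phi))$; (4) $X,Y$ are complete and first countable, $Z_0$ is barreled, $\Phi$ is $K$-epi closed, and $0_Z\in\operatorname{icr}(\pi(\operatorname{dom}\Phi))$; (5) $\Phi(x,0_Z)\leqq_K\Phi(x,z)$ for all $(x,z)\in\operatorname{dom}\Phi$, and $\operatorname{int}(\pi(\operatorname{dom}\Phi))\neq\emptyset$. Then $(\alpha)\Leftrightarrow(\beta)$ for all $(L,y)\in\mathcal L(X,Y)\times Y$. If, in addition, there exists $\tilde x\in X$ with $(\tilde x,0_Z)\in\operatorname{dom}\Phi$ and $\Phi(\tilde x,z)\leqq_K\Phi(\tilde x,0_Z)$ for all $z\in-S$, then also $(\alpha)\Leftrightarrow(\gamma)$ for all $(L,y)\in\mathcal L(X,Y)\times Y$.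
   Context: Ordering: $K$ proper means $K\ne Y$. $y_1\leqq_K y_2$ iff $y_1-y_2\in-K$; $y_1<_K y_2$ iff $y_1-y_2\in-\operatorname{int}K$. $Y^\infty=Y\cup\{+\infty_Y\}$, $Y^\bullet=Y\cup\{-\infty_Y,+\infty_Y\}$, where $-\infty_Y<_K y<_K+\infty_Y$ for $y\in Y$, $-\infty_Y<_K+\infty_Y$, $-(+\infty_Y)=-\infty_Y$, $y+(\pm\infty_Y)=\pm\infty_Y$ for $y\in Y$; in particular $+\infty_Y\not\leqq_K y$ for $y\in Y$ and $+\infty_Y\notin-\operatorname{int}K$. Weak supremum: for $M\subset Y^\bullet$, $\operatorname{WSup}M$ is the set of $\bar v\in Y^\bullet$ such that $\bar v\not<_K v$ for all $v\in M$ and for every $\tilde v\in Y^\bullet$ with $\tilde v<_K\bar v$ there is $v\in M$ with $\tilde v<_K v$. $\mathcal L(X,Y)$ is the space of continuous linear maps $X\to Y$. $\operatorname{dom}\Phi=\{(x,z):\Phi(x,z)\neq+\infty_Y\}$; $\Phi$ is $K$-convex (resp. $K$-epi closed) if $\{(x,z,y)\in X\times Z\times Y:y\in\Phi(x,z)+K\}$ is convex (resp. closed). $\Phi^*(L,T)=\operatorname{WSup}\{L(x)+T(z)-\Phi(x,z):(x,z)\in X\times Z\}$ for $(L,T)\in\mathcal L(X,Y)\times\mathcal L(Z,Y)$. $\mathcal L_\Phi=\{T\in\mathcal L(Z,Y):\exists L\in\mathcal L(X,Y),\ \Phi^*(L,T)\neq\{+\infty_Y\}\}$, $\mathcal L_+(S,K)=\{T\in\mathcal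 L(Z,Y):T(S)\subset K\}$, $\mathcal L_\Phi^+=\mathcal L_\Phi\cap\mathcal L_+(S,K)$. In (2), continuity at $0_Z$ means: $\Phi(\widehat x,0_Z)\in Y$ and for every neighborhood $V$ of $\Phi(\widehat x,0_Z)$ in $Y$ there is a neighborhood $N$ of $0_Z$ with $\Phi(\widehat x,z)\in V$ for all $z\in N\cap Z_0$. $\operatorname{lin}$, $\operatorname{aff}$ are linear and affine hulls; $\operatorname{ri}U$ is the interior of $U$ relative to $\operatorname{aff}U$; $\operatorname{icr}U=\{z\in Z:\forall z'\in\operatorname{aff}U\ \exists\delta>0,\ z+\lambda z'\in U\ \forall\lambda\in[0,\delta]\}$. Complete: every Cauchy net converges. Barreled: every absorbing convex closed subset is a neighborhood of the origin. *)

(* Defs.v *)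
From HB Require Import structures.
From mathcomp Require Import all_boot all_order all_algebra.
From mathcomp Require Import all_classical all_reals all_analysis.

Set Implicit Arguments.
Unset Strict Implicit.
Unset Printing Implicit Defensive.

Import Order.TTheory GRing.Theory Num.Theory.
Import numFieldNormedType.Exports.

Local Open Scope classical_set_scope.
Local Open Scope ring_scope.

(* A locally convex topological vector space over [R : realType] is a
   [tvsType R]; [hausdorff_space] is assumed separately.
   [Y^bullet = Y U {-oo, +oo}] is [\bar Y], with its [adde] and [oppe]; on the
   elements which are added below these agree with the usual rules, since
   [+oo] and [-oo] are never added to each other.  A map into [Y U {+oo}] is
   a map into [\bar Y] that avoids [-oo]. *)

(* The scalars are positive, so [0] need not belong to a cone. *)
Definition convex_cone (R : realType) (E : tvsType R) (C : set E) : Prop :=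
  convex_set C /\ forall (t : R) (x : E), 0 < t -> C x -> C (t *: x).

Definition lin_hull (R : realType) (E : tvsType R) (A : set E) : set E :=
  [set x | exists (n : nat) (c : 'I_n -> R) (v : 'I_n -> E),
     (forall i, A (v i)) /\ x = \sum_(i < n) c i *: v i].

Definition aff_hull (R : realType) (E : tvsType R) (A : set E) : set E :=
  [set x | exists (n : nat) (c : 'I_n -> R) (v : 'I_n -> E),
     [/\ forall i, A (v i), \sum_(i < n) c i = 1
       & x = \sum_(i < n) c i *: v i]].

Definition finite_dim (R : realType) (E : tvsType R) (V : set E) : Prop :=
  exists (n : nat) (b : 'I_n -> E), V = lin_hull (range b).

Definition rel_interior (R : realType) (E : tvsType R) (U : set E) : set E :=
  [set z | aff_hull U z /\ within (aff_hull U) (nbhs z) U].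

Definition icr (R : realType) (E : tvsType R) (U : set E) : set E :=
  [set z | forall z', aff_hull U z' ->
     exists2 d : R, 0 < d & forall l : R, 0 <= l <= d -> U (z + l *: z')].

(* The library's [cauchy] is not used: a [tvsType] carries a uniformity
   inducing its topology, but not necessarily the one of the additive group. *)
Definition complete_tvs (R : realType) (E : tvsType R) : Prop :=
  forall (I : Type) (le : I -> I -> Prop) (u : I -> E),
    (exists i : I, True) ->
    (forall i, le i i) ->
    (forall i j k, le i j -> le j k -> le i k) ->
    (forall i j, exists k, le i k /\ le j k) ->
    (forall U : set E, nbhs 0 U ->
       exists i0, forall i j, le i0 i -> le i0 j -> U (u i - u j)) ->
    exists l : E, forall V : set E, nbhs l V ->
      exists i0, forall i, le i0 i -> V (u i).

Definition first_countable (T : topologicalType) : Prop :=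
  forall x : T, exists B : nat -> set T,
    (forall n, nbhs x (B n)) /\
    (forall U : set T, nbhs x U -> exists n, B n `<=` U).

(* Barreledness of the linear subspace [V] of [E], for the induced topology. *)
Definition barreled_subspace (R : realType) (E : tvsType R) (V : set E) :
    Prop :=
  forall B : set E,
    B `<=` V ->
    (forall z, V z ->
       exists2 d : R, 0 < d & forall l : R, `|l| <= d -> B (l *: z)) ->
    convex_set B ->
    (exists2 C : set E, closed C & B = C `&` V) ->
    within V (nbhs 0) B.

(* Only instances whose right-hand side lies in [Y] are used below; the other
   infinite cases follow the convention [-oo <= v <= +oo]. *)
Definition leK (R : realType) (Y : tvsType R) (K : set Y) (u v : \bar Y) :
    Prop :=
  match u, v with
  | EFin a, EFin b => (-%R @` K) (a - b)
  | ENInf, _ => True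
  | _, EPInf => True
  | _, _ => False
  end.

Definition ltK (R : realType) (Y : tvsType R) (K : set Y) (u v : \bar Y) :
    Prop :=
  match u, v with
  | EFin a, EFin b => (-%R @` K°) (a - b)
  | ENInf, EFin _ => True
  | EFin _, EPInf => True
  | ENInf, EPInf => True
  | _, _ => False
  end.

Definition neg_int (R : realType) (Y : tvsType R) (K : set Y) : set (\bar Y) :=
  EFin @` (-%R @` K°).

Definition WSup (R : realType) (Y : tvsType R) (K : set Y) (M : set (\bar Y)) :
    set (\bar Y) :=
  [set w | (forall v, M v -> ~ ltK K w v) /\
           (forall w', ltK K w' w -> exists2 v, M v & ltK K w' v)].

Definition cont_linear (R : realType) (E F : tvsType R) :
    set {linear E -> F} := [set f | continuous f].

Definition dom (R : realType) (X Y Z : tvsType R) (Phi : X * Z -> \bar Y) :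
    set (X * Z) := [set p | Phi p <> +oo%E].

Definition epiK (R : realType) (X Y Z : tvsType R) (K : set Y)
    (Phi : X * Z -> \bar Y) : set (X * Z * Y) :=
  [set q | exists2 k, K k & q.2%:E = (Phi q.1 + k%:E)%E].

Definition K_convex (R : realType) (X Y Z : tvsType R) (K : set Y)
    (Phi : X * Z -> \bar Y) : Prop := convex_set (epiK K Phi).

Definition K_epi_closed (R : realType) (X Y Z : tvsType R) (K : set Y)
    (Phi : X * Z -> \bar Y) : Prop := closed (epiK K Phi).

Definition conjugate (R : realType) (X Y Z : tvsType R) (K : set Y)
    (Phi : X * Z -> \bar Y) (L : {linear X -> Y}) (T : {linear Z -> Y}) :
    set (\bar Y) :=
  WSup K [set ((L p.1)%:E + (T p.2)%:E - Phi p)%E | p in [set: X * Z]].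

Definition L_Phi (R : realType) (X Y Z : tvsType R) (K : set Y)
    (Phi : X * Z -> \bar Y) : set {linear Z -> Y} :=
  [set T | cont_linear T /\
     exists2 L : {linear X -> Y}, cont_linear L &
       conjugate K Phi L T <> [set +oo%E]].

Definition L_plus (R : realType) (Y Z : tvsType R) (S : set Z) (K : set Y) :
    set {linear Z -> Y} := [set T | cont_linear T /\ T @` S `<=` K].

Definition L_Phi_plus (R : realType) (X Y Z : tvsType R) (K : set Y)
    (S : set Z) (Phi : X * Z -> \bar Y) : set {linear Z -> Y} :=
  L_Phi K Phi `&` L_plus S K.

Definition cond_alpha (R : realType) (X Y Z : tvsType R) (K : set Y)
    (Phi : X * Z -> \bar Y) (L : {linear X -> Y}) (y : Y) : Prop :=
  forall x : X, ~ neg_int K (Phi (x, 0%R) - (L x)%:E + y%:E)%E.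

Definition cond_beta (R : realType) (X Y Z : tvsType R) (K : set Y)
    (Phi : X * Z -> \bar Y) (L : {linear X -> Y}) (y : Y) : Prop :=
  exists2 T : {linear Z -> Y}, L_Phi K Phi T &
    forall (x : X) (z : Z),
      ~ neg_int K (Phi (x, z) - (L x)%:E - (T z)%:E + y%:E)%E.

Definition cond_gamma (R : realType) (X Y Z : tvsType R) (K : set Y) (S : set Z)
    (Phi : X * Z -> \bar Y) (L : {linear X -> Y}) (y : Y) : Prop :=
  exists2 T : {linear Z -> Y}, L_Phi_plus K S Phi T &
    forall (x : X) (z : Z),
      ~ neg_int K (Phi (x, z) - (L x)%:E - (T z)%:E + y%:E)%E.

(* Main.v *)
(** A separator for [(L, y)] is a continuous linear form [g] on [Z] such that
  [Phi(x, z) - L(x) + y - g(z) k0] is never in [-int K], where [k0] is a fixed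
  interior point of [K]; then [T = g(.) k0] is the operator of [(beta)], and [T]
  is in [L_Phi] because [y] bounds the set whose weak supremum is the conjugate.

  Let [A] in [Y * Z] be the union over [x] of the epigraphs of
  [Phi(x, .) - L(x) + y]; by [(alpha)] its section at [0] misses [-int K].  For
  a convex set [V], a form [g] with [g <= c] on [V] is obtained from a linear
  minorant of the sublinear functional on [Y * Z] which is at most [0] at
  [(-a, z)] for [(a, z)] in [A], at most [r] at [(w, 0)] if [r k0 - w] is in
  [K], and at most [c] at [(0, v)] for [v] in [V].  This minorant takes the value
  [1] at [(k0, 0)], so its restriction to [Y] is a nonzero element of the dual
  cone.

  In (i) one takes [V = -S] and [c = 0].  In (ii), cases (1)-(4), [V] is a
  neighborhood of [0] such that [(yh, z)] is in [A] for some [yh] and all [z] in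
  [V] and [Z0]: in (3) because a convex set which contains small multiples of
  [b_i] and [-b_i] for a basis [b] of [Z0] is a neighborhood of [0] in [Z0], in
  (4) by Ursescu's open mapping theorem.  In (5) the form [g = 0] works. *)

Require Import Defs.
From HB Require Import structures.
From mathcomp Require Import all_boot all_order all_algebra.
From mathcomp Require Import all_classical all_reals all_analysis.
From mathcomp Require Import ring lra.

Set Implicit Arguments.
Unset Strict Implicit.
Unset Printing Implicit Defensive.

Import Order.TTheory GRing.Theory Num.Theory.
Import numFieldNormedType.Exports.

Local Open Scope classical_set_scope.
Local Open Scope ring_scope.

(** * Linear minorants from maximal cones *)

(* A maximal cone, for inclusion, is the epigraph of a linear form. *)
Lemma cone_linear_minorant (R : realType) (E : lmodType R) (C : set (E * R)) :
  (forall e r e' r', C (e, r) -> C (e', r') -> C (e + e', r + r')) ->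
  (forall t e r, 0 < t -> C (e, r) -> C (t *: e, t * r)) ->
  C (0, 0) -> (forall e, exists r, C (e, r)) ->
  (forall r, C (0, r) -> 0 <= r) ->
  exists f : {scalar E}, forall e r, C (e, r) -> f e <= r.
Proof.
move=> CD CZ C00 Ctot Cpos.
pose good (D : set (E * R)) := [/\ C `<=` D,
  forall e r e' r', D (e, r) -> D (e', r') -> D (e + e', r + r'),
  forall t e r, 0 < t -> D (e, r) -> D (t *: e, t * r) &
  forall r, D (0, r) -> 0 <= r].
have [F FP Ftot|D [Dgood Dmax]] := @Zorn_bigcup _ [set D | D = set0 \/ good D].
  have [[D [FD D0]]|noD] := pselect (exists D, F D /\ D <> set0); last first.
    left; apply/seteqP; split => // p [D FD Dp]; apply: noD; exists D; split=> //.
    by move=> D0; move: Dp; rewrite D0.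
  have Fgood D' : F D' -> D' <> set0 -> good D' by move=> /FP[].
  have Fg D' p : F D' -> D' p -> good D'.
    by move=> FD' pD'; apply: Fgood => // D'0; move: pD'; rewrite D'0.
  right; split.
  - by have [CDs _ _ _] := Fgood _ FD D0; move=> p /CDs pD; exists D.
  - move=> e r e' r' [D1 FD1 D1e] [D2 FD2 D2e].
    have [D12|D21] := Ftot _ _ FD1 FD2.
      by exists D2 => //; have [_ + _ _] := Fg _ _ FD2 D2e; apply=> //; exact: D12.
    by exists D1 => //; have [_ + _ _] := Fg _ _ FD1 D1e; apply=> //; exact: D21.
  - move=> t e r t0 [D1 FD1 D1e]; exists D1 => //.
    by have [_ _ + _] := Fg _ _ FD1 D1e; exact.
  - by move=> r [D1 FD1 D1e]; have [_ _ _] := Fg _ _ FD1 D1e; exact.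
have {Dgood}[CsD DD DZ Dpos] : good D.
  case: Dgood => // D0; exfalso; apply: (Dmax C); last by right; split.
  rewrite D0; split => // C0; have [r Cr] := Ctot 0.
  exact: (C0 _ Cr).
pose S e := [set r | D (e, r)].
have S0 e : S e !=set0 by have [r /CsD] := Ctot e; exists r.
have Slb e : has_lbound (S e).
  have [r Dr] := S0 (- e); exists (- r) => r' Dr'; rewrite lerNl -subr_ge0 opprK.
  by apply: Dpos; have := DD _ _ _ _ Dr' Dr; rewrite subrr addrC.
pose f e := inf (S e).
have f_lb e r : D (e, r) -> f e <= r by move=> Der; exact: ge_inf.
(* Adjoining the ray of [(- y, - f y)] keeps [D] good: [D (t *: y, r + t * f y)] with [0 < t] gives
   [f y <= r / t + f y], hence [0 <= r]. By maximality the ray already lies in [D]. *)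
have DfN y : D (- y, - f y).
  pose D' := [set p | exists2 t, 0 <= t & D (p.1 + t *: y, p.2 + t * f y)].
  have DD' : D `<=` D'.
    by move=> [e r] Der; exists 0 => //=; rewrite scale0r mul0r !addr0.
  have D'g : good D'.
    split.
    - exact: subset_trans DD'.
    - move=> e r e' r' [t t0 /= D1] [t' t'0 /= D2]; exists (t + t') => /=.
        exact: addr_ge0.
      by rewrite scalerDl mulrDl addrACA [r + r' + _]addrACA; exact: DD.
    - move=> t e r t0 [s s0 /= D1]; exists (t * s) => /=.
        by rewrite mulr_ge0// ltW.
      by rewrite -scalerA -mulrA -scalerDr -mulrDr; exact: DZ.
    - move=> r [t t0 /=]; rewrite add0r.
      have [->|tn0] := eqVneq t 0; first by rewrite scale0r mul0r addr0; exact: Dpos.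
      have {}t0 : 0 < t by rewrite lt_neqAle eq_sym tn0.
      move=> /(DZ t^-1)-/(_ _); rewrite invr_gt0 => /(_ t0).
      rewrite scalerA mulVf// scale1r => /f_lb.
      by rewrite mulrDr mulrA mulVf// mul1r lerDr pmulr_rge0// invr_gt0.
  have DeqD' : D' `<=` D.
    move=> p D'p; apply: contrapT => Dp; apply: (Dmax D'); last by right.
    by split => // /(_ _ D'p).
  by apply: DeqD'; exists 1 => //=; rewrite scale1r mul1r !addNr; exact: CsD.
have fD x y : f (x + y) <= f x + f y.
  rewrite -lerBlDr; apply: lb_le_inf => // r Dr; rewrite lerBlDr -lerBlDl.
  by apply: lb_le_inf => // r' Dr'; rewrite lerBlDl; apply/f_lb/DD.
have fN x : f (- x) = - f x.
  apply/eqP; rewrite eq_le f_lb//= -subr_ge0 opprK.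
  by apply: le_trans (fD _ _); rewrite addNr; apply: lb_le_inf => // r /Dpos.
have {}fD x y : f (x + y) = f x + f y.
  by apply/eqP; rewrite eq_le fD/= -lerBrDr -fN -[in leLHS](addrK y x) fD.
have fZ_le t x : 0 < t -> f (t *: x) <= t * f x.
  move=> t0; rewrite -ler_pdivrMl//; apply: lb_le_inf => // r Dr.
  by rewrite ler_pdivrMl//; apply/f_lb/DZ.
have fZ t x : 0 < t -> f (t *: x) = t * f x.
  move=> t0; apply/eqP; rewrite eq_le fZ_le//=.
  have := fZ_le t^-1 (t *: x); rewrite invr_gt0 => /(_ t0).
  by rewrite scalerA mulVf ?gt_eqF// scale1r ler_pdivlMl.
have fs : scalar f.
  move=> t x y; rewrite fD; congr (_ + _).
  have f0 : f 0 = 0 by apply: (addrI (f 0)); rewrite -fD !addr0.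
  have [t0|t0|->] := ltgtP t 0; last by rewrite scale0r mul0r.
    by rewrite -[t]opprK scaleNr fN mulNr fZ// oppr_gt0.
  exact: fZ.
pose g : {scalar E} := HB.pack f (GRing.isLinear.Build _ _ _ _ f fs).
by exists g => e r /CsD /f_lb.
Qed.

(** * Convex sets and neighborhoods of 0 *)

Lemma convex_setP (R : realType) (E : lmodType R) (A : set E) :
  convex_set A <-> forall s t x y, 0 <= s -> 0 <= t -> s + t = 1 ->
    A x -> A y -> A (s *: x + t *: y).
Proof.
split=> [Acvx s t x y s0 t0 st1 Ax Ay|Acvx x y l /set_mem Ax /set_mem Ay].
  have s1 : s <= 1 by rewrite -st1 lerDl.
  have -> : t = 1 - s by rewrite -st1 addrAC subrr add0r.
  exact: set_mem (Acvx x y (Itv01 s0 s1) (mem_set Ax) (mem_set Ay)).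
apply/mem_set; apply: (Acvx l%:num (1 - l%:num)) => //.
by rewrite addrC subrK.
Qed.

(** If [s + t = 0], both coefficients vanish and any point of [A] serves; otherwise normalize. It
    makes the nonnegative multiples of a convex set stable under addition. *)
Lemma convex_set_combine (R : realType) (E : lmodType R) (A : set E) s t x y :
  convex_set A -> 0 <= s -> 0 <= t -> A x -> A y ->
  exists2 z, A z & s *: x + t *: y = (s + t) *: z.
Proof.
move=> /convex_setP Acvx s0 t0 Ax Ay.
have [/eqP|st0] := eqVneq (s + t) 0.
  rewrite paddr_eq0// => /andP[/eqP-> /eqP->]; exists x => //.
  by rewrite addr0 !scale0r addr0.
exists ((s / (s + t)) *: x + (t / (s + t)) *: y).
  by apply: Acvx => //; rewrite ?divr_ge0 ?addr_ge0// -mulrDl divff.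
by rewrite scalerDr !scalerA !(mulrC (s + t)) !divfK.
Qed.

Lemma convex_setZ (R : realType) (E : lmodType R) (A : set E) l x :
  convex_set A -> A 0 -> 0 <= l <= 1 -> A x -> A (l *: x).
Proof.
move=> /convex_setP Acvx A0 /andP[l0 l1] Ax.
rewrite -[_ *: _]addr0 -[in X in _ + X](scaler0 _ (1 - l)).
by apply: Acvx => //; rewrite ?subr_ge0// addrC subrK.
Qed.

Section tvs_lemmas.
Variables (R : realType) (E : tvsType R).
Implicit Types (U V : set E) (x y : E).

Lemma nbhs0_shift U x : nbhs x U <-> nbhs 0 [set y | U (x + y)].
Proof.
split=> [|U0].
  move=> /(nbhsB (- x)); rewrite addNr; apply: filterS => _ [y Uy <-] /=.
  by rewrite addrA subrr add0r.
by have := nbhsT x U0; apply: filterS => _ [y /= Uxy <-].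
Qed.

Lemma nbhs0_addl U : nbhs 0 U ->
  exists2 V, nbhs 0 V & forall x y, V x -> V y -> U (x + y).
Proof.
move=> U0; have := @add_continuous E (0, 0) U; rewrite /= addr0 => /(_ U0).
move=> [[A B] /= [A0 B0] AB]; exists (A `&` B); first exact: filterI.
by move=> x y [Ax _] [_ By]; exact: (AB (x, y)).
Qed.

Lemma nbhs0_scale U t : t != 0 -> nbhs 0 U -> nbhs 0 [set x | U (t *: x)].
Proof.
move=> t0 /(nbhs0Z (invr_neq0 t0)); apply: filterS => _ [x Ux <-] /=.
by rewrite scalerA divff// scale1r.
Qed.

Lemma nbhs0_oppr U : nbhs 0 U -> nbhs 0 [set x | U (- x)].
Proof. by move=> /nbhs0N; apply: filterS => _ [x Ux <-] /=; rewrite opprK. Qed.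

Lemma nbhs_ray U x y : nbhs x U ->
  exists2 d : R, 0 < d & forall l, `|l| <= d -> U (x + l *: y).
Proof.
move=> /nbhs0_shift U0.
have := @scale_continuous R E (0, y) _; rewrite /= scale0r => /(_ _ U0).
move=> [[A B] /= [A0 B0] AB].
move: A0 => /nbhs_ballP[e /= e0 eA]; exists (e / 2); first by rewrite divr_gt0.
move=> l le; apply: (AB (l, y)); split => /=; last exact: nbhs_singleton.
apply: eA; rewrite -ball_normE /= sub0r normrN (le_lt_trans le)//.
by rewrite ltr_pdivrMr// ltr_pMr// ltr1n.
Qed.

Lemma nbhs0_convex U : nbhs 0 U -> exists V,
  [/\ nbhs 0 V, convex_set V, (forall x, V x -> V (- x)) & V `<=` U].
Proof.
have [B Bcvx [Bo Bb]] := @locally_convex R E.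
move=> /Bb[W /= [BW W0] WU]; exists (W `&` [set x | W (- x)]).
have W0' : nbhs 0 W by apply: open_nbhs_nbhs; split => //; exact: Bo.
split.
- by apply: filterI => //; exact: nbhs0_oppr.
- have /convex_setP Wc := Bcvx _ (mem_set BW).
  apply/convex_setP => s t x y s0 t0 st1 [Wx WNx] [Wy WNy]; split; first exact: Wc.
  by rewrite /= opprD -!scalerN; exact: Wc.
- by move=> x [Wx WNx]; split => //=; rewrite opprK.
- by move=> x [/WU].
Qed.

Lemma closure_nbhs0 (A : set E) x : closure A x <->
  forall U, nbhs 0 U -> exists2 a, A a & U (a - x).
Proof.
split=> [clA U U0|clA U /nbhs0_shift/clA[a Aa /=]]; last first.
  by rewrite addrC subrK => Ua; exists a.
have : nbhs x [set a | U (a - x)].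
  apply/nbhs0_shift; apply: filterS U0 => y Uy /=.
  by rewrite addrAC subrr add0r.
by move=> /clA[a [Aa Ua]]; exists a.
Qed.

Lemma convex_closure (A : set E) : convex_set A -> convex_set (closure A).
Proof.
move=> /convex_setP Acvx; apply/convex_setP => s t x y s0 t0 st1.
move=> /closure_nbhs0 clx /closure_nbhs0 cly; apply/closure_nbhs0 => U.
move=> /nbhs0_convex[V [V0 /convex_setP Vcvx _ VU]].
have [a Aa Va] := clx _ V0; have [b Ab Vb] := cly _ V0.
exists (s *: a + t *: b); first exact: Acvx.
by apply: VU; rewrite opprD addrACA -!scalerBr; exact: Vcvx.
Qed.

(** Symmetrizing [U] about [x] turns the one-sided bound into [|g| <= M] on a neighborhood of 0; by
    homogeneity [g] is then small on small multiples of that neighborhood. *)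
Lemma scalar_continuous (g : {scalar E}) U x c :
  nbhs x U -> (forall y, U y -> g y <= c) -> continuous (g : E -> R).
Proof.
move=> /nbhs0_shift U0 gU.
pose M := `|c - g x| + 1.
have M0 : 0 < M by rewrite ltr_pwDr.
pose V := [set y | U (x + y) /\ U (x - y)].
have V0 : nbhs 0 V by apply: filterI => //; exact: (nbhs0_oppr U0).
have gV y : V y -> `|g y| <= M.
  move=> [Uy UNy]; have := gU _ Uy; have := gU _ UNy.
  rewrite linearB linearD /= ler_norml => h1 h2.
  have := ler_norm (c - g x); rewrite /M => h3; apply/andP; split; lra.
move=> y; apply/cvgrPdist_lt => e e0.
(* If [(2 * M / e) *: z] lies in [V], then [|g z| <= e / 2]. *)
have t0 : 2 * M / e != 0 by rewrite !mulf_neq0 ?invr_eq0 ?gt_eqF.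
apply/nbhs0_shift; apply: filterS (nbhs0_scale t0 V0) => z /= /gV.
rewrite linearZ /= normrM gtr0_norm ?divr_gt0 ?mulr_gt0// => h.
rewrite linearD opprD addrA subrr add0r normrN.
move: h; rewrite -ler_pdivlMl ?divr_gt0 ?mulr_gt0// => /le_lt_trans; apply.
rewrite (_ : (2 * M / e)^-1 * M = e / 2); last by field; rewrite !gt_eqF.
by rewrite ltr_pdivrMr// ltr_pMr// ltr1n.
Qed.

End tvs_lemmas.

(** * The ordering cone and the separation lemma *)

Section ordering_cone.
Variables (R : realType) (Y : tvsType R) (K : set Y).
Hypotheses (K_cone : convex_cone K) (K_closed : closed K).
Hypotheses (K_proper : K <> [set: Y]).

Lemma coneD x y : K x -> K y -> K (x + y).
Proof.
have [/convex_setP Kcvx KZ] := K_cone => Kx Ky.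
have h2 : 0 < 2 :> R by [].
rewrite -[x + y](scalerK (_ : 2^-1 != 0 :> R)) ?invr_eq0// invrK; apply: KZ => //.
by rewrite scalerDr; apply: Kcvx => //; rewrite [RHS]splitr mul1r.
Qed.

Lemma coneZ t x : 0 < t -> K x -> K (t *: x).
Proof. by case: K_cone => _; exact. Qed.

Lemma cone_intD x y : K° x -> K y -> K° (x + y).
Proof.
move=> /(nbhsB y); rewrite addrC => Kx Ky; apply: filterS Kx => _ [z Kz <-].
exact: coneD.
Qed.

Lemma cone_intZ t x : 0 < t -> K° x -> K° (t *: x).
Proof.
move=> t0 Kx; have tn0 : t != 0 by rewrite gt_eqF.
by apply: filterS (nbhsZ tn0 Kx) => _ [z Kz <-]; exact: coneZ.
Qed.

Lemma cone_int0 : ~ K° 0.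
Proof.
move=> K0; apply: K_proper; apply/seteqP; split => // x _.
have [d d0 /(_ d)] := nbhs_ray x K0.
rewrite gtr0_norm// add0r => /(_ (lexx _)) Kdx.
by rewrite -[x](scalerK (lt0r_neq0 d0)); apply: coneZ; rewrite ?invr_gt0.
Qed.

Variable k0 : Y.
Hypothesis (k0_int : K° k0).

Let Kk0 : K k0. Proof. exact: nbhs_singleton. Qed.

(** Cones are only stable under positive scalars, so [0] is obtained from closedness, as a limit of
    small multiples of [k0]. *)
Lemma cone0 : K 0.
Proof.
rewrite (closure_id K).1//; apply/closure_nbhs0 => U U0.
have [d d0 /(_ d)] := nbhs_ray k0 U0.
rewrite gtr0_norm// add0r => /(_ (lexx _)) Udk.
by exists (d *: k0); rewrite ?subr0//; exact: coneZ.
Qed.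

(** An interior point is an order unit: [k0 - d *: w] stays in [K] for small [d]; divide by [d]. *)
Lemma cone_dominates w : exists2 r, 0 < r & K (r *: k0 - w).
Proof.
have [d d0 /(_ d)] := nbhs_ray (- w) k0_int.
rewrite gtr0_norm// => /(_ (lexx _)) Kd; exists d^-1; first by rewrite invr_gt0.
rewrite -[w](scalerK (lt0r_neq0 d0)) -scalerBr -scalerN.
by apply: coneZ; rewrite ?invr_gt0.
Qed.

(** That every [z] decomposes makes the sublinear functional less than [+oo] everywhere; the last
    hypothesis makes it nonnegative at 0. These are the two requirements of
    [cone_linear_minorant]. *)
Lemma scalar_separation (Z : lmodType R) (A : set (Y * Z)) (V : set Z) (c : R) :
  convex_set A -> A !=set0 -> convex_set V -> V !=set0 ->
  (forall z, exists t s a u, [/\ 0 <= t, 0 <= s, A a, V u &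
    z = t *: a.2 + s *: u]) ->
  (forall t s a u, 0 <= t -> 0 <= s -> A a -> V u -> t *: a.2 + s *: u = 0 ->
    ~ K° (- (t *: a.1 + (s * c) *: k0))) ->
  exists2 g : {scalar Z}, (forall a, A a -> ~ K° (g a.2 *: k0 - a.1)) &
    forall u, V u -> g u <= c.
Proof.
move=> Acvx [a0 Aa0] Vcvx [u0 Vu0] tot pos.
(* With [p = ((w, z), r)], the point [(w, z)] is split into [t] times [(- a.1, a.2)], [s] times
   [(0, u)], and [(w + t *: a.1, 0)]; these cost at most [0], [s * c] and [r - s * c]. *)
pose C := [set p : (Y * Z) * R | exists t s a u, [/\ 0 <= t, 0 <= s, A a, V u &
  p.1.2 = t *: a.2 + s *: u /\
  K ((p.2 - s * c) *: k0 - (p.1.1 + t *: a.1))]].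
have [|||||f fC] := @cone_linear_minorant R (Y * Z)%type C.
- move=> e r e' r' [t [s [a [u [t0 s0 Aa Vu [/= zE Kp]]]]]].
  move=> [t' [s' [a' [u' [t'0 s'0 Aa' Vu' [/= zE' Kp']]]]]].
  have [a'' Aa'' aE] := convex_set_combine Acvx t0 t'0 Aa Aa'.
  have [u'' Vu'' uE] := convex_set_combine Vcvx s0 s'0 Vu Vu'.
  have [aE1 aE2] : t *: a.1 + t' *: a'.1 = (t + t') *: a''.1 /\
      t *: a.2 + t' *: a'.2 = (t + t') *: a''.2.
    by split; [have := congr1 fst aE|have := congr1 snd aE].
  exists (t + t'), (s + s'), a'', u''; split; rewrite ?addr_ge0//; split => /=.
    by rewrite zE zE' -aE2 -uE addrACA.
  rewrite mulrDl opprD [r + _ + _]addrACA scalerDl -aE1 [e.1 + _ + _]addrACA.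
  by rewrite opprD addrACA; exact: coneD.
- move=> l e r l0 [t [s [a [u [t0 s0 Aa Vu [/= zE Kp]]]]]].
  exists (l * t), (l * s), a, u; split; rewrite ?mulr_ge0 ?(ltW l0)//=; split.
    by rewrite zE scalerDr !scalerA.
  by rewrite -mulrA -mulrBr -!scalerA -scalerDr -scalerBr; exact: coneZ.
- exists 0, 0, a0, u0; split => //=; split; first by rewrite !scale0r addr0.
  by rewrite mul0r !scale0r subr0 scale0r !addr0 subr0; exact: cone0.
- move=> [w z]; have [t [s [a [u [t0 s0 Aa Vu zE]]]]] := tot z.
  have [r r0 Kr] := cone_dominates (w + t *: a.1).
  by exists (r + s * c), t, s, a, u; split => //; split => //=; rewrite addrK.
- move=> r [t [s [a [u [t0 s0 Aa Vu [/= /esym zE]]]]]]; rewrite add0r => Kp.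
  (* A negative [r] would add the interior point [(- r) *: k0] to an element of [K], which [pos]
     excludes. *)
  rewrite leNgt; apply/negP => r0; apply: (pos t s a u) => //.
  have -> : - (t *: a.1 + (s * c) *: k0) =
      (- r) *: k0 + ((r - s * c) *: k0 - t *: a.1).
    by rewrite addrA -scalerDl addKr scaleNr [in LHS]addrC opprD.
  by apply: cone_intD => //; apply: cone_intZ => //; rewrite oppr_gt0.
pose g0 z := f (0, z).
have gs : scalar g0.
  move=> l x y; rewrite /g0.
  have -> : (0, l *: x + y) = l *: (0, x) + (0, y) :> Y * Z.
    by rewrite /GRing.scale /GRing.add /=; congr (_, _); rewrite /= scaler0 addr0.
  by rewrite linearP.
pose g : {scalar Z} := HB.pack g0 (GRing.isLinear.Build _ _ _ _ g0 gs).
have fE w z : f (w, z) = f (w, 0) + g z.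
  rewrite -linearD; congr (f _).
  by rewrite /GRing.add /=; congr (_, _); rewrite /= ?addr0 ?add0r.
have f1 w r : K (r *: k0 - w) -> f (w, 0) <= r.
  move=> Kw; apply: fC; exists 0, 0, a0, u0; split => //=; split.
    by rewrite !scale0r addr0.
  by rewrite mul0r scale0r subr0 addr0.
have fk0 : f (k0, 0) = 1.
  apply/eqP; rewrite eq_le f1 ?scale1r ?subrr//=; last exact: cone0.
  rewrite -lerN2 -linearN; apply: fC; exists 0, 0, a0, u0; split => //=; split.
    by rewrite !scale0r addr0 oppr0.
  by rewrite mul0r scale0r subr0 addr0 scaleN1r subrr; exact: cone0.
have fZ r : f (r *: k0, 0) = r.
  have -> : (r *: k0, 0) = r *: (k0, 0) :> Y * Z.
    by rewrite /GRing.scale /=; congr (_, _); rewrite /= scaler0.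
  by rewrite linearZ /= fk0 mulr1.
exists g.
  move=> a Aa Ka.
  have ga : g a.2 <= f (a.1, 0).
    rewrite -subr_ge0 -oppr_le0 opprB addrC.
    have -> : - f (a.1, 0) = f (- a.1, 0).
      rewrite -linearN; congr (f _).
      by rewrite /GRing.opp /=; congr (_, _); rewrite oppr0.
    rewrite -fE; apply: fC; exists 1, 0, a, u0; split => //=; split.
      by rewrite scale1r scale0r addr0.
    by rewrite mul0r subr0 scale0r scale1r addNr subr0; exact: cone0.
  (* Being interior leaves room to subtract [d *: k0], so [f (a.1, 0) <= g a.2 - d], against
     [ga]. *)
  have [d d0 /(_ (- d))] := nbhs_ray k0 Ka.
  rewrite normrN gtr0_norm// => /(_ (lexx _)) Kd.
  have : f (a.1, 0) <= g a.2 - d.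
    by apply: f1; rewrite scalerBl addrAC -scaleNr.
  by move=> /(le_trans ga); rewrite lerDl oppr_ge0 leNgt d0.
move=> u Vu; apply: fC; exists 0, 1, a0, u; split => //=; split.
  by rewrite scale0r scale1r add0r.
by rewrite mul1r subrr !scale0r !addr0 subr0; exact: cone0.
Qed.

End ordering_cone.

(** * Ursescu's open mapping theorem for closed convex relations *)

(** The weights [1/2, ..., 2^-n], completed by a second [2^-n] for [x], add up to 1. *)
Lemma geometric_convex_sum (R : realType) (E : lmodType R) (A : set E)
    (a : nat -> E) (x : E) n :
  convex_set A -> (forall k, A (a k)) -> A x ->
  A (\sum_(k < n) 2^-1 ^+ k.+1 *: a k + 2^-1 ^+ n *: x).
Proof.
move=> /convex_setP Acvx Aa; elim: n x => [|n IHn] x Ax.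
  by rewrite big_ord0 add0r expr0 scale1r.
rewrite big_ord_recr /= -addrA exprSr -!scalerA -scalerDr; apply: IHn.
by apply: Acvx => //; rewrite [RHS]splitr mul1r.
Qed.

(** Sequences suffice below: the only limit taken is that of the partial sums of a series. *)
Definition sequentially_complete (R : realType) (E : tvsType R) : Prop :=
  forall u : nat -> E,
    (forall U : set E, nbhs 0 U -> exists n0, forall i j,
       (n0 <= i)%N -> (n0 <= j)%N -> U (u i - u j)) ->
    exists l : E, forall V : set E, nbhs l V ->
      exists n0, forall i, (n0 <= i)%N -> V (u i).

Lemma complete_sequentially (R : realType) (E : tvsType R) :
  complete_tvs E -> sequentially_complete E.
Proof.
move=> cE u uC; apply: (cE _ leq u) => //; first by exists 0%N.
- by move=> i j k; exact: leq_trans.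
- by move=> i j; exists (maxn i j); rewrite leq_maxl leq_maxr.
Qed.

Lemma sequentially_complete_prod (R : realType) (E F : tvsType R) :
  sequentially_complete E -> sequentially_complete F ->
  sequentially_complete (E * F)%type.
Proof.
move=> cE cF u uC.
have [|l1 ul1] := cE (fst \o u).
  move=> U U0; have [|n un] := uC [set p | U p.1].
    by exists (U, setT) => /=; [split => //; exact: filterT | move=> p []].
  by exists n.
have [|l2 ul2] := cF (snd \o u).
  move=> U U0; have [|n un] := uC [set p | U p.2].
    by exists (setT, U) => /=; [split => //; exact: filterT | move=> p []].
  by exists n.
exists (l1, l2) => V [[V1 V2] /= [/ul1[n1 n1V] /ul2[n2 n2V]] V12].
exists (maxn n1 n2) => i; rewrite geq_max => /andP[ni1 ni2].
by apply: V12; split; [exact: n1V|exact: n2V].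
Qed.

Lemma first_countable_prod (E F : topologicalType) :
  first_countable E -> first_countable F -> first_countable (E * F)%type.
Proof.
move=> cE cF [x y]; have [B [Bx BU]] := cE x; have [C [Cy CU]] := cF y.
pose BC n := match unpickle n with Some (i, j) => B i `*` C j | None => setT end.
exists BC; split.
  move=> n; rewrite /BC; case: (unpickle n) => [[i j]|]; last exact: filterT.
  by exists (B i, C j) => /=; [split|].
move=> U [[V W] /= [/BU[i iV] /CU[j jW]] VW]; exists (pickle (i, j)).
by rewrite /BC pickleK => p [/iV ? /jW ?]; exact: VW.
Qed.

(** Shrink each member of a countable base to a symmetric convex neighborhood inside [N], and let
    [U n] be the intersection of those of index at most [n]. *)
Lemma decreasing_convex_base (R : realType) (E : tvsType R) (N : set E) :
  first_countable E -> nbhs 0 N -> exists U : nat -> set E,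
  [/\ forall n, nbhs 0 (U n), forall n, convex_set (U n),
      forall n x, U n x -> U n (- x),
      forall m n, (m <= n)%N -> U n `<=` U m &
      U 0%N `<=` N /\ forall W, nbhs 0 W -> exists n, U n `<=` W].
Proof.
move=> /(_ 0)[B [B0 BW]] N0.
have [C CP] := choice (fun n => nbhs0_convex (filterI (B0 n) N0)).
pose U n := [set x | forall k, (k <= n)%N -> C k x].
exists U; split.
- elim=> [|n IHn].
    have [C0 _ _ _] := CP 0%N.
    by apply: filterS C0 => x Cx k; rewrite leqn0 => /eqP->.
  have [C0 _ _ _] := CP n.+1; apply: filterS2 IHn C0 => x Ux Cx k.
  by rewrite leq_eqVlt => /predU1P[->//|]; rewrite ltnS; exact: Ux.
- move=> n; apply/convex_setP => s t x y s0 t0 st1 Ux Uy k kn.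
  have [_ /convex_setP Ccvx _ _] := CP k.
  by apply: Ccvx => //; [exact: Ux|exact: Uy].
- by move=> n x Ux k kn; have [_ _ + _] := CP k; apply; exact: Ux.
- by move=> m n mn x Ux k km; apply: Ux; exact: leq_trans mn.
- split; first by move=> x /(_ 0%N (leqnn _)); have [_ _ _ CBN] := CP 0%N => /CBN[].
  move=> W /BW[n BnW]; exists n => x /(_ n (leqnn _)).
  by have [_ _ _ CBN] := CP n => /CBN[/BnW].
Qed.

(* Ursescu's open mapping argument.  For [r] in the closure of [Rel 0], put
   [r_0 = r] and [r_(n+1) = 2 (r_n - z_n)] with [(e_n, z_n)] in [G], [e_n] in
   [U n] and [z_n] so close to [r_n] that [r_(n+1)] is in the closure of
   [Rel n.+1]; then [r / 2 = \sum 2^-(n+1) z_n] is related by [G] to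
   [\sum 2^-(n+1) e_n].  As [Z] need not be first countable, the first series
   need not converge in [Z]: instead, the remainder [2^-(n+1) r_n] is replaced
   by a nearby element of [2^-(n+1) Rel n] before using that [G] is closed. *)
Lemma closed_convex_relation_open (R : realType) (E Z : tvsType R)
    (G : set (E * Z)) (Z0 : set Z) (N : set E) :
  convex_set G -> closed G -> G (0, 0) ->
  (forall s t x y, Z0 x -> Z0 y -> Z0 (s *: x + t *: y)) ->
  (forall e z, G (e, z) -> Z0 z) ->
  barreled_subspace Z0 ->
  (forall z, Z0 z -> exists2 l, 0 < l & exists e, G (e, l *: z)) ->
  sequentially_complete E -> first_countable E ->
  nbhs 0 N -> convex_set N -> closed N ->
  within Z0 (nbhs 0) [set z | exists2 e, N e & G (e, z)].
Proof.
move=> Gcvx Gcl G0 Z0lin GZ0 Z0bar Gabs Ecpl Efc N0 Ncvx Ncl.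
have [U [U0 Ucvx UN Umono [UsubN UW]]] := decreasing_convex_base Efc N0.
have U00 n : U n 0 by exact: nbhs_singleton (U0 n).
pose Rel n := [set z | exists2 e, U n e & G (e, z)].
pose V n := closure (Rel n) `&` Z0.
have Z00 : Z0 0 by exact: GZ0 G0.
have Z0Z s x : Z0 x -> Z0 (s *: x).
  by move=> Zx; rewrite -[_ *: _]addr0 -(scale0r x); exact: Z0lin.
(* Multiplying [(e, m *: z)] by a factor in [[0, 1]] stays in [G], as [G] is convex and contains the
   origin, and small factors bring [e] into [U n]. *)
have Relabs n z : Z0 z -> exists2 d, 0 < d & forall l, 0 <= l <= d -> Rel n (l *: z).
  move=> /Gabs[m m0 [e Ge]].
  have [d1 d10 Ud1] := nbhs_ray e (U0 n).
  exists (Num.min d1 1 * m); first by rewrite mulr_gt0// lt_min d10/=.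
  move=> l /andP[l0 ld].
  have lm0 : 0 <= l / m by rewrite divr_ge0// ltW.
  have : l / m <= Num.min d1 1 by rewrite ler_pdivrMr.
  rewrite le_min => /andP[lmd lm1].
  exists ((l / m) *: e).
    by have := Ud1 (l / m); rewrite add0r ger0_norm//; exact.
  have -> : ((l / m) *: e, l *: z) = (l / m) *: (e, m *: z) :> E * Z.
    by rewrite /GRing.scale /=; congr (_, _); rewrite /= scalerA divfK// gt_eqF.
  by apply: convex_setZ => //; rewrite lm0.
have Relcvx n : convex_set (Rel n).
  apply/convex_setP => s t x y s0 t0 st1 [e Ue Ge] [e' Ue' Ge'].
  exists (s *: e + t *: e'); first exact: (convex_setP _).1.
  exact: ((convex_setP _).1 Gcvx s t (e, x) (e', y)).
(* [V n] is a barrel of [Z0]: [Relabs] at [z] and at [- z] makes it absorbing. *)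
have V0 n : within Z0 (nbhs 0) (V n).
  apply: Z0bar.
  - by move=> z [].
  - move=> z Zz; have [d1 d10 H1] := Relabs n z Zz.
    have [d2 d20 H2] := Relabs n (- z) ltac:(rewrite -scaleN1r; exact: Z0Z).
    exists (Num.min d1 d2); first by rewrite lt_min d10.
    move=> l; rewrite le_min => /andP[l1 l2]; split; last exact: Z0Z.
    apply: subset_closure; have [l0|l0] := leP 0 l.
      by apply: H1; rewrite l0 (le_trans _ l1)// ler_norm.
    rewrite -[l *: z]opprK -scaleNr -scalerN; apply: H2.
    by rewrite oppr_ge0 ltW//= (le_trans _ l2)// -normrN ler_norm.
  - apply/convex_setP => s t x y s0 t0 st1 [cx Zx] [cy Zy]; split; last exact: Z0lin.
    exact: (convex_setP _).1 (convex_closure (@Relcvx n)) _ _ _ _ _ _ _ _ _.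
  - by exists (closure (Rel n)) => //; exact: closed_closure.
suff half r : V 0%N r -> exists2 e, N e & G (e, 2^-1 *: r).
  have h2 : 2 != 0 :> R by [].
  apply: filterS (nbhs0_scale h2 (V0 0%N)) => z /= Vz Zz.
  have [e Ne] := half _ (Vz (Z0Z _ _ Zz)).
  by rewrite scalerA mulVf// scale1r; exists e.
move=> Vr.
have step (p : nat * Z) : exists q : E * Z, V p.1 p.2 ->
    [/\ U p.1 q.1, G q & V p.1.+1 (2 *: (p.2 - q.2))].
  have [[clp Zp]|nV] := pselect (V p.1 p.2); last by exists 0.
  have h2 : - 2 != 0 :> R by rewrite oppr_eq0.
  have /closure_nbhs0/(_ _ (nbhs0_scale h2 (V0 p.1.+1)))[z [e Ue Ge] /= Vz] := clp.
  exists (e, z) => _ /=; split => //.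
  rewrite -[_ - _]opprK scalerN -scaleNr opprB; apply: Vz; apply: (Z0Z).
  by rewrite -[z]scale1r -scaleN1r; apply: Z0lin => //; exact: GZ0 Ge.
have {step}[F FP] := choice step.
pose fix r_ n := if n is m.+1 then 2 *: (r_ m - (F (m, r_ m)).2) else r.
pose a n := F (n, r_ n).
have Vr_ n : V n (r_ n) by elim: n => //= n /(FP (n, _))[].
have Ua n : U n (a n).1 by have [] := FP (n, _) (Vr_ n).
have Ga n : G (a n) by have [] := FP (n, _) (Vr_ n).
pose S n := \sum_(k < n) 2^-1 ^+ k.+1 *: a k.
pose s n := \sum_(k < n) 2^-1 ^+ k.+1 *: (a k).1.
have S1 n : (S n).1 = s n.
  by elim: n => [|n IHn]; rewrite /S /s ?big_ord0// !big_ord_recr/= -/(S n) IHn.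
(* The sum telescopes, since [r_ n] is [(a n).2] plus half of [r_ n.+1]. *)
have S2 n : (S n).2 = 2^-1 *: r - 2^-1 ^+ n.+1 *: r_ n.
  elim: n => [|n IHn]; first by rewrite /S big_ord0 /= expr1 subrr.
  rewrite /S big_ord_recr /= -/(S n) IHn -addrA; congr (_ + _).
  rewrite [in RHS]exprSr -scalerA [2^-1 *: (2 *: _)]scalerA mulVf// scale1r.
  by rewrite scalerBr opprB addrC.
have half01 n : 0 <= (2^-1 : R) ^+ n <= 1.
  by rewrite exprn_ge0 ?exprn_ile1 ?invr_ge0 ?invf_le1 ?ler1n.
(* The block of terms from [i] to [i + j] is [2^-i] times a convex combination of points of [U i],
   with [0] taking the leftover weight. *)
have sD i j : U i (s (i + j)%N - s i).
  have -> : s (i + j)%N - s i =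
      2^-1 ^+ i *: (\sum_(k < j) 2^-1 ^+ k.+1 *: (a (i + k)%N).1 + 2^-1 ^+ j *: 0).
    rewrite /s big_split_ord /= addrAC subrr add0r scaler0 addr0 scaler_sumr.
    by apply: eq_bigr => k _; rewrite scalerA -exprD addnS.
  apply: convex_setZ => //.
  apply: (geometric_convex_sum (a := fun k => (a (i + k)%N).1)) => // k.
  by apply: Umono (Ua _); exact: leq_addr.
have [|e se] := Ecpl s.
  move=> W /nbhs0_addl[W' /UW[n nW'] W'W]; exists n => i j ni nj.
  rewrite -(subnKC ni) -(subnKC nj) -[s (n + (i - n))%N](subrK (s n)) -addrA.
  apply: W'W; apply: nW'; first exact: sD.
  by rewrite -opprB; apply/UN/sD.
exists e.
  rewrite (closure_id N).1// => W /se[n nW]; exists (s n); split; last exact: nW.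
  have NU k : N (a k).1 by apply/UsubN/Umono/Ua.
  have := geometric_convex_sum n Ncvx NU (nbhs_singleton N0).
  by rewrite scaler0 addr0.
rewrite (closure_id G).1//; apply/closure_nbhs0 => W [[W1 W2] /= [W10 W20] W12].
have [W1' W1'0 W1'D] := nbhs0_addl W10.
have [W2' [W2'0 W2'cvx _ W2'W]] := nbhs0_convex W20.
have : nbhs e [set x | W1' (x - e)].
  by apply/nbhs0_shift; apply: filterS W1'0 => x Wx /=; rewrite addrAC subrr add0r.
move=> /se[n1 n1W]; have [n2 n2W] := UW _ W1'0.
pose n := maxn n1 n2.
have [/closure_nbhs0/(_ _ W2'0)[z' [e' Ue' Ge'] Wz'] _] := Vr_ n.
(* The leftover weight [2^-n] is shared equally between [(e', z')] and the origin, so that the [Z]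
   component differs from [2^-1 *: r] by [2^-(n+1)] times [z' - r_ n] only. *)
exists (S n + 2^-1 ^+ n *: (2^-1 *: (e', z') + 2^-1 *: 0)).
  apply: geometric_convex_sum => //; apply: (convex_setP _).1 => //.
  by rewrite [RHS]splitr mul1r.
have -> : S n + 2^-1 ^+ n *: (2^-1 *: (e', z') + 2^-1 *: 0) - (e, 2^-1 *: r) =
    ((s n - e) + 2^-1 ^+ n.+1 *: e', 2^-1 ^+ n.+1 *: (z' - r_ n)).
  rewrite scaler0 addr0 scalerA -exprSr; apply: injective_projections => /=.
    by rewrite S1 addrAC.
  by rewrite S2 addrAC [X in X + _]addrAC subrr sub0r addrC -scalerBr.
apply: W12; split => /=.
  apply: W1'D; first by apply: n1W; exact: leq_maxl.
  by apply/n2W/(Umono _ n); [exact: leq_maxr|exact: convex_setZ].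
by apply: W2'W; apply: convex_setZ => //; exact: nbhs_singleton.
Qed.

(** * Finite-dimensional subspaces *)

Lemma scale_vector_continuous (R : realType) (E : tvsType R) (v : E) :
  continuous (fun r : R => r *: v).
Proof.
move=> r.
exact: (cvg_comp2 cvg_id (cvg_cst v) (@scale_continuous R E (r, v))).
Qed.

Lemma lin_hull_range (R : realType) (E : tvsType R) n (b : 'I_n -> E) x :
  lin_hull (range b) x <-> exists c : 'I_n -> R, x = \sum_i c i *: b i.
Proof.
split=> [[m [c [v [bv ->]]]]|[c ->]]; last first.
  by exists n, c, b; split=> // i; exists i.
have bv' i : exists j, b j = v i by have [j _] := bv i; exists j.
have [s sv] := choice bv'.
exists (fun j => \sum_(i | s i == j) c i).
rewrite (partition_big s xpredT)//=; apply: eq_bigr => j _.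
rewrite scaler_suml; apply: eq_bigr => i /eqP sij.
by rewrite -sij sv.
Qed.

(** A spanning family of minimal length is free: a nontrivial relation would express one [b j]
    through the others, which would then span. *)
Lemma finite_dim_basis (R : realType) (E : tvsType R) (V : set E) :
  finite_dim V -> exists n (b : 'I_n -> E),
    (forall x, V x <-> exists c : 'I_n -> R, x = \sum_i c i *: b i) /\
    (forall c : 'I_n -> R, \sum_i c i *: b i = 0 -> forall i, c i = 0).
Proof.
pose P n := `[< exists b : 'I_n -> E,
  forall x, V x <-> exists c : 'I_n -> R, x = \sum_i c i *: b i >].
move=> [n0 [b0 VE]].
have exP : exists n, P n.
  by exists n0; apply/asboolP; exists b0 => x; rewrite VE lin_hull_range.
case: (ex_minnP exP) => n /asboolP[b bE] nmin.
exists n, b; split=> // c cb0 j; apply: contrapT => /eqP cj0.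
have n0' : (0 < n)%N by apply: leq_ltn_trans (ltn_ord j).
suff : P n.-1 by move/nmin; rewrite -ltnS prednK// ltnn.
apply/asboolP; exists (b \o lift j) => x.
have bj : b j = \sum_(k < n.-1) - (c (lift j k) / c j) *: b (lift j k).
  move: cb0; rewrite (bigD1_ord j)//= => /eqP; rewrite addr_eq0 => /eqP cbj.
  rewrite -[LHS](scalerK cj0) cbj scalerN scaler_sumr -sumrN.
  by apply: eq_bigr => k _; rewrite scalerA scaleNr mulrC.
rewrite bE; split=> -[d ->].
  exists (fun k => d (lift j k) - d j * (c (lift j k) / c j)).
  rewrite (bigD1_ord j)//= bj scaler_sumr -big_split /=; apply: eq_bigr => k _.
  by rewrite scalerA -scalerDl mulrN addrC.
exists (fun i => if unlift j i is Some k then d k else 0).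
rewrite [RHS](bigD1_ord j)//= unlift_none scale0r add0r.
by apply: eq_bigr => k _; rewrite liftK.
Qed.

(* The faces [c i = 1] of the unit cube are compact and do not meet the kernel
   of the coordinate map, so their images avoid a neighborhood of [0]. *)
Lemma free_coordinates_bounded (R : realType) (E : tvsType R) n (b : 'I_n -> E) :
  hausdorff_space E ->
  (forall c : 'I_n -> R, \sum_i c i *: b i = 0 -> forall i, c i = 0) ->
  nbhs 0 [set x | forall c : 'I_n -> R, x = \sum_i c i *: b i ->
    forall i, `|c i| <= 1].
Proof.
move=> hE bfree.
pose phi (c : 'I_n -> R) := \sum_i c i *: b i.
have phic : continuous (phi : prod_topology (fun _ : 'I_n => R) -> E).
  move=> c; apply: (@cvg_big E 'I_n +%R 0 xpredT (@add_continuous E) _ (nbhs c)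
    (index_enum _) (fun i (c : 'I_n -> R) => c i *: b i)) => i _.
  have ci := @proj_continuous _ (fun _ : 'I_n => R) i.
  exact: (cvg_comp _ _ (ci c) (@scale_vector_continuous R E (b i) (c i))).
pose face (i j : 'I_n) : set R := if j == i then [set 1] else [set` `[-1, 1]].
pose F i := [set c : prod_topology (fun _ : 'I_n => R) | forall j, face i j (c j)].
have faceN i : nbhs 0 (~` (phi @` F i)).
  apply: open_nbhs_nbhs; split.
    apply: closed_openC; apply: compact_closed => //.
    apply: continuous_compact; first exact: continuous_subspaceT.
    apply: tychonoff => j; rewrite /face; case: ifP => _; first exact: compact_set1.
    exact: segment_compact.
  move=> [c Fc] /bfree/(_ i) ci0; have := Fc i; rewrite /face eqxx /= ci0.
  by move/eqP; rewrite eq_sym oner_eq0.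
have [V VP] := choice (fun i => nbhs0_convex (faceN i)).
have : \forall x \near (0 : E), forall i, V i x.
  by apply: filter_forall => i; have [] := VP i.
apply: filterS => x Vx c xE i0; rewrite leNgt; apply/negP => ci0.
(* Dividing by the coordinate of largest modulus puts [c] on the face [F i]. As this modulus exceeds
   1, [x / c i] also lies in the symmetric convex set [V i], which avoids the image of that face. *)
have [i _ ci] := @arg_maxP _ _ _ i0 predT (fun i => `|c i|) isT.
have c1 : 1 < `|c i| by apply: lt_le_trans ci0 _; exact: ci.
have cn0 : c i != 0 by rewrite -normr_gt0 (lt_trans _ c1).
have [Vi0 Vicvx ViN ViF] := VP i.
have : V i ((c i)^-1 *: x).
  have VZ l : 0 <= l <= 1 -> V i (l *: x).
    by move=> l01; apply: convex_setZ => //; exact: nbhs_singleton.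
  have c01 : 0 <= `|c i|^-1 <= 1.
    by rewrite invr_ge0 normr_ge0/= invf_le1 ?ltW// (lt_trans _ c1).
  have [cp|cn] := leP 0 (c i); first by rewrite -(ger0_norm cp); exact: VZ.
  rewrite -[c i]opprK -(ltr0_norm cn) invrN scaleNr; apply: ViN; exact: VZ.
move=> /ViF; apply; exists (fun j => c j / c i).
  move=> j; rewrite /face; case: eqP => [->|_] /=; first by rewrite divff.
  rewrite in_itv /= -ler_norml normrM normfV ler_pdivrMr ?mul1r ?normr_gt0//.
  exact: ci.
rewrite /phi xE scaler_sumr; apply: eq_bigr => j _.
by rewrite scalerA mulrC.
Qed.

Lemma convex_set_sum (R : realType) (E : lmodType R) (A : set E) n
    (a : 'I_n -> E) : convex_set A -> A 0 -> (forall i, A (a i)) ->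
  exists2 x, A x & \sum_i a i = n%:R *: x.
Proof.
move=> Acvx A0; elim: n a => [|n IHn] a Aa.
  by exists 0 => //; rewrite big_ord0 scaler0.
have [x Ax xE] := IHn (fun i => a (lift ord0 i)) (fun i => Aa _).
have [|y Ay yE] :=
  @convex_set_combine _ _ A 1 n%:R (a ord0) x Acvx ler01 _ (Aa _) Ax.
  exact: ler0n.
by exists y => //; rewrite big_ord_recl xE -nat1r -yE scale1r.
Qed.

(** Near 0 the coordinates of [x] are so small that [x] is [n / n.+1] times an average of [n] points
    of [B], each on a segment from 0 to some [d *: b i] or [- d *: b i]. *)
Lemma finite_dim_convex_nbhs (R : realType) (E : tvsType R) (V : set E) :
  hausdorff_space E -> finite_dim V -> exists n (b : 'I_n -> E),
    (forall i, V (b i)) /\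
    forall (d : R) (B : set E), 0 < d -> convex_set B -> B 0 ->
      (forall i, B (d *: b i) /\ B (- d *: b i)) -> within V (nbhs 0) B.
Proof.
move=> hE /finite_dim_basis[n [b [bV bfree]]]; exists n, b.
split=> [i|d B d0 Bcvx B0 Bb].
  apply/bV; exists (fun j => (j == i)%:R).
  rewrite (bigD1 i)//= eqxx scale1r big1 ?addr0// => j /negbTE->.
  by rewrite scale0r.
(* Using [n.+1] instead of [n] keeps the factor nonzero when [V] is trivial. *)
have t0 : n.+1%:R / d != 0 by rewrite mulf_neq0 ?invr_eq0 ?gt_eqF.
apply: filterS (nbhs0_scale t0 (free_coordinates_bounded hE bfree)) => x /= xN.
move=> /bV[c xE].
have cB i : B (((n.+1%:R / d) * c i) *: (d *: b i)).
  have : `|n.+1%:R / d * c i| <= 1.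
    apply: (xN (fun i => n.+1%:R / d * c i)); rewrite xE scaler_sumr.
    by apply: eq_bigr => j _; rewrite scalerA.
  have [Bp] := Bb i; rewrite scaleNr => Bn.
  have [c0|c0] := leP 0 (n.+1%:R / d * c i).
    by rewrite ger0_norm// => c1; apply: convex_setZ => //; rewrite c0.
  rewrite ltr0_norm// => c1; rewrite -[_ / _ * _]opprK scaleNr -scalerN.
  by apply: convex_setZ => //; rewrite c1 oppr_ge0 ltW.
have [y By yE] := convex_set_sum Bcvx B0 cB.
have -> : x = (n%:R / n.+1%:R) *: y.
  rewrite mulrC -scalerA -yE scaler_sumr xE; apply: eq_bigr => i _.
  by rewrite !scalerA; congr (_ *: _); field; rewrite gt_eqF//= pnatr_eq0.
apply: convex_setZ => //; rewrite divr_ge0//= ler_pdivrMr// mul1r ler_nat.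
exact: leqnSn.
Qed.

(** * Hulls, rank-one operators and continuity *)

Lemma lin_hull_self (R : realType) (E : tvsType R) (A : set E) : A `<=` lin_hull A.
Proof.
move=> x Ax; exists 1%N, (fun=> 1), (fun=> x); split=> //.
by rewrite big_ord1 scale1r.
Qed.

Lemma lin_hull_combine (R : realType) (E : tvsType R) (A : set E) s t x y :
  lin_hull A x -> lin_hull A y -> lin_hull A (s *: x + t *: y).
Proof.
move=> [m [c [v [Av ->]]]] [n [d [w [Aw ->]]]].
exists (m + n)%N, (fun i => match fintype.split i with
    | inl j => s * c j | inr j => t * d j end),
  (fun i => match fintype.split i with inl j => v j | inr j => w j end).
split=> [i|]; first by case: (fintype.split i).
rewrite big_split_ord /= !scaler_sumr; congr (_ + _); apply: eq_bigr => i _.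
  by rewrite (unsplitK (inl i)) scalerA.
by rewrite (unsplitK (inr i)) scalerA.
Qed.

Lemma lin_hullZ (R : realType) (E : tvsType R) (A : set E) t x :
  lin_hull A x -> lin_hull A (t *: x).
Proof.
by move=> Ax; rewrite -[_ *: _]addr0 -(scale0r x); exact: lin_hull_combine.
Qed.

(** The point [0] takes the weight missing from 1. *)
Lemma aff_hull_lin (R : realType) (E : tvsType R) (A : set E) :
  A 0 -> lin_hull A `<=` aff_hull A.
Proof.
move=> A0 x [n [c [v [Av ->]]]].
exists n.+1, (fun i => if unlift ord0 i is Some j then c j else 1 - \sum_j c j),
  (fun i => if unlift ord0 i is Some j then v j else 0).
split=> [i||]; first by case: (unlift ord0 i).
  rewrite big_ord_recl unlift_none -[RHS](subrK (\sum_j c j)); congr (_ + _).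
  by apply: eq_bigr => i _; rewrite liftK.
rewrite big_ord_recl unlift_none scaler0 add0r.
by apply: eq_bigr => i _; rewrite liftK.
Qed.

Lemma finite_upper_bound (R : realType) (I : finType) (f : I -> R) :
  exists2 M : R, 0 < M & forall i, f i <= M.
Proof.
exists (1 + \sum_i `|f i|); first by rewrite ltr_pwDl ?sumr_ge0.
move=> i; rewrite (bigD1 i)//= addrCA (le_trans (ler_norm _))// lerDl.
by rewrite addr_ge0// sumr_ge0.
Qed.

Section rank_one.
Variables (R : realType) (E F : tvsType R) (g : {scalar E}) (k : F).

Definition rank_one (x : E) : F := g x *: k.

Lemma rank_one_is_linear : linear rank_one.
Proof.
by move=> t x y; rewrite /rank_one linearP scalerDl scalerA.
Qed.

HB.instance Definition _ :=
  GRing.isLinear.Build R E F *:%R rank_one rank_one_is_linear.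

Lemma rank_one_continuous : continuous (g : E -> R) -> continuous rank_one.
Proof.
move=> gc x.
exact: (cvg_comp _ _ (gc x) (@scale_vector_continuous R F k (g x))).
Qed.

End rank_one.

Lemma continuous_translate (R : realType) (E : tvsType R) (a : E) :
  continuous (fun x => a + x).
Proof.
move=> x.
exact: (cvg_comp2 (cvg_cst a) cvg_id (@add_continuous E (a, x))).
Qed.

Lemma continuous_pair (T U V : topologicalType) (f : T -> U) (g : T -> V) :
  continuous f -> continuous g -> continuous (fun x => (f x, g x)).
Proof. by move=> fc gc x; exact: (cvg_pair (fc x) (gc x)). Qed.

Lemma neg_intP (R : realType) (Y : tvsType R) (K : set Y) u :
  neg_int K u%:E <-> K° (- u).
Proof.
split=> [[_ [v Kv <-] [<-]]|Ku]; first by rewrite opprK.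
by exists u => //; exists (- u) => //; rewrite opprK.
Qed.

(** * The perturbed epigraph and its separators *)

Section perturbation.
Variables (R : realType) (X Y Z : tvsType R) (K : set Y).
Hypotheses (K_cone : convex_cone K) (K_closed : closed K).
Hypotheses (K_proper : K <> [set: Y]).
Variable k0 : Y.
Hypothesis (k0_int : K° k0).
Variables (S : set Z) (S_cone : convex_cone S) (S_nonempty : S !=set0).
Variable (Phi : X * Z -> \bar Y).
Hypotheses (Phi_Yinf : forall p, Phi p <> -oo%E) (Phi_convex : K_convex K Phi).
Hypothesis (Phi_dom : (snd @` dom Phi) 0).
Variables (L : {linear X -> Y}) (y : Y).
Hypothesis (L_cont : cont_linear L).

Local Notation pidom := (snd @` dom Phi).
Local Notation Z0 := (lin_hull pidom).

Let K0 : K 0. Proof. exact: cone0 k0_int. Qed.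

Definition perturbed_epi : set (Y * Z) :=
  [set a | exists x w, epiK K Phi (x, a.2, w) /\ a.1 = w - L x + y].

Local Notation A := perturbed_epi.

Lemma dom_fin p : dom Phi p -> exists a, Phi p = a%:E.
Proof.
by rewrite /dom /=; have := @Phi_Yinf p; case: (Phi p) => // a; exists a.
Qed.

Lemma epiKP p a w : Phi p = a%:E -> (epiK K Phi (p, w) <-> K (w - a)).
Proof.
move=> Pa; split=> [[k Kk /=]|Kwa].
  by rewrite Pa => -[->]; rewrite addrAC subrr add0r.
exists (w - a) => //=; rewrite Pa.
by change (w%:E = (a + (w - a))%:E); rewrite addrC subrK.
Qed.

Lemma epiK_dom p w : epiK K Phi (p, w) -> dom Phi p.
Proof. by move=> [k _ /= + Pp]; rewrite Pp. Qed.

Lemma epiK_le p q w : epiK K Phi (p, w) ->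
  leK K (Phi q) (Phi p) -> epiK K Phi (q, w).
Proof.
move=> epw; have [a Pa] := dom_fin (epiK_dom epw).
move: epw; rewrite (epiKP _ Pa) Pa => Kwa.
have := @Phi_Yinf q; case Pq: (Phi q) => [b| |] // _ [k Kk kE].
rewrite (epiKP _ Pq); have -> : w - b = (w - a) + k.
  by rewrite -[k]opprK kE opprB addrA subrK.
exact: coneD.
Qed.

Lemma perturbed_epi_convex : convex_set A.
Proof.
apply/convex_setP => s t a b s0 t0 st1 [x [w [exw aE]]] [x' [w' [exw' bE]]].
exists (s *: x + t *: x'), (s *: w + t *: w'); split.
  exact: ((convex_setP _).1 Phi_convex s t (x, a.2, w) (x', b.2, w')).
have -> : L (s *: x + t *: x') = s *: L x + t *: L x' by rewrite linearD !linearZ.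
rewrite /= aE bE !scalerDr !scalerN opprD.
rewrite -[y in RHS]scale1r -st1 scalerDl.
by rewrite [s *: w + t *: w' + _]addrACA [RHS]addrACA.
Qed.

Lemma perturbed_epi_up a z k : A (a, z) -> K k -> A (a + k, z).
Proof.
move=> [x [w [exw /= ->]]] Kk; exists x, (w + k) => /=; split.
  have [b Pb] := dom_fin (epiK_dom exw).
  by move: exw; rewrite !(epiKP _ Pb) addrAC => Kw; exact: coneD.
by rewrite addrAC; congr (_ + _); rewrite addrAC.
Qed.

Lemma perturbed_epi_dom a : A a -> pidom a.2.
Proof. by move=> [x [w [/epiK_dom xd _]]]; exists (x, a.2). Qed.

Lemma pidom_perturbed_epi z : pidom z -> exists a, A (a, z).
Proof.
move=> [[x z'] xd /= <-]; have [a Pa] := dom_fin xd.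
by exists (a - L x + y), x, a; split => //; apply/(epiKP _ Pa); rewrite subrr.
Qed.

Definition separator (g : {scalar Z}) :=
  continuous (g : Z -> R) /\ forall a, A a -> ~ K° (g a.2 *: k0 - a.1).

Lemma alpha_perturbed_epi : cond_alpha K Phi L y ->
  forall a, A (a, 0) -> ~ K° (- a).
Proof.
move=> al a [x [w [exw /= ->]]] Ka; apply: (al x).
have [b Pb] := dom_fin (epiK_dom exw).
move: exw; rewrite (epiKP _ Pb) Pb => Kwb; apply/neg_intP.
have -> : - (b - L x + y) = - (w - L x + y) + (w - b).
  have E u v c : - (u + c) = - (v + c) + (v - u) :> Y.
    by rewrite [v + c]addrC (opprD c v) addrA subrK opprD addrC.
  by rewrite -(addrA b) -(addrA w); exact: E.
exact: cone_intD.
Qed.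

Lemma cont_linear_L_Phi (T : {linear Z -> Y}) : cont_linear T ->
  (forall x z, ~ neg_int K (Phi (x, z) - (L x)%:E - (T z)%:E + y%:E)%E) ->
  L_Phi K Phi T.
Proof.
move=> Tc sep; split => //; exists L => // conj_oo.
(* If [+oo] were a weak supremum, then [y], being below it, would be below some value
   [L x + T z - Phi (x, z)], which the separation forbids. *)
have [_ /(_ y%:E I)[_ [[x z] _ <-]]] : conjugate K Phi L T +oo%E.
  by rewrite conj_oo.
have := sep x z; have := @Phi_Yinf (x, z).
case: (Phi (x, z)) => [a| |]//= _ nsep [k Kk kE]; apply: nsep; apply/neg_intP.
suff <- : k = - (a - L x - T z + y) by [].
by apply: oppr_inj; rewrite kE opprK opprB opprD (addrA a) [RHS]addrC.
Qed.

Lemma separator_sep (g : {scalar Z}) : separator g -> forall x z,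
  ~ neg_int K (Phi (x, z) - (L x)%:E - (rank_one g k0 z)%:E + y%:E)%E.
Proof.
move=> [_ gA] x z; have := @Phi_Yinf (x, z).
case Pa: (Phi (x, z)) => [a| |]// _; last by move=> [].
move=> /neg_intP Ka; apply: (gA (a - L x + y, z)).
  by exists x, a; split => //; apply/(epiKP _ Pa); rewrite subrr.
suff -> : g z *: k0 - (a - L x + y) = - (a - L x - rank_one g k0 z + y) by [].
by rewrite (addrAC (a - L x)) [RHS]opprB.
Qed.

Lemma separator_beta (g : {scalar Z}) : separator g -> cond_beta K Phi L y.
Proof.
move=> sg; exists (rank_one g k0); last exact: separator_sep.
apply: cont_linear_L_Phi; last exact: separator_sep.
by case: sg => gc _; exact: rank_one_continuous.
Qed.

Lemma separator_gamma (g : {scalar Z}) :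
  separator g -> (forall s, S s -> 0 <= g s) -> cond_gamma K S Phi L y.
Proof.
move=> sg gS; exists (rank_one g k0); last exact: separator_sep.
have gc : continuous (rank_one g k0) by case: sg => ? _; exact: rank_one_continuous.
split; first by apply: cont_linear_L_Phi => //; exact: separator_sep.
split=> // _ [s /gS + <-]; rewrite le_eqVlt /= /rank_one => /predU1P[<-|gs0].
  by rewrite scale0r.
by apply: coneZ => //; exact: nbhs_singleton.
Qed.

Lemma beta_alpha : cond_beta K Phi L y -> cond_alpha K Phi L y.
Proof.
move=> [T _ sep] x; have := sep x 0; rewrite linear0.
case: (Phi (x, 0)) => [a| |] //.
by have -> : (a%:E - (L x)%:E + y%:E)%E = (a - L x - 0 + y)%:E by rewrite subr0.
Qed.

Lemma gamma_beta : cond_gamma K S Phi L y -> cond_beta K Phi L y.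
Proof. by move=> [T [TL _] sep]; exists T. Qed.

(** Apply the separation lemma to [-S] with [c = 0]. A point of [A] over [z] in [S] can be moved
    over [0] by monotonicity of [Phi], where [(alpha)] applies. *)
Lemma separator_of_interior_cone :
  (exists z s, [/\ pidom z, S° s & 0 = z - s]) ->
  (forall x z, dom Phi (x, z) -> S z -> leK K (Phi (x, 0)) (Phi (x, z))) ->
  cond_alpha K Phi L y ->
  exists2 g, separator g & forall s, S s -> 0 <= g s.
Proof.
move=> [s0 [s [sdom sint /esym/eqP]]]; rewrite subr_eq0 => /eqP zs Phile al.
rewrite {}zs in sdom; have [a Aas] := pidom_perturbed_epi sdom.
have [Scvx SZ] := S_cone.
have AS b z : A (b, z) -> S z -> A (b, 0).
  move=> [x [w [exw /= ->]]] Sz; exists x, w; split=> //=.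
  by apply: (epiK_le exw); apply: Phile => //; exact: epiK_dom exw.
pose V : set Z := [set u | S (- u)].
have Vcvx : convex_set V.
  apply/convex_setP => p q u v p0 q0 pq1 Su Sv; rewrite /V /= opprD -!scalerN.
  exact: (convex_setP _).1.
have [||||g gA gV] :=
  @scalar_separation R Y K K_cone K_closed k0 k0_int Z A V 0
    perturbed_epi_convex _ Vcvx.
- by exists (a, s).
- by have [u Su] := S_nonempty; exists (- u); rewrite /V /= opprK.
- move=> z; have [d d0 /(_ (- d))] := nbhs_ray z sint.
  rewrite normrN gtr0_norm// => /(_ (lexx _)) Sd.
  (* [s - d *: z] is in [S] for small [d], and [z] is [d^-1] times the sum of [s] and
     [d *: z - s]. *)
  exists d^-1, d^-1, (a, s), (d *: z - s); split => //.
  + by rewrite invr_ge0 ltW.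
  + by rewrite invr_ge0 ltW.
  + by rewrite /V /= opprB addrC -scaleNr addrC.
  + by rewrite -scalerDr /= addrC subrK scalerA mulVf ?scale1r// gt_eqF.
- move=> t r [b z] u t0 r0 Abz Vu /= tru; rewrite mulr0 scale0r addr0.
  have [->|tn0] := eqVneq t 0; first by rewrite scale0r oppr0; exact: cone_int0.
  have {}t0 : 0 < t by rewrite lt_neqAle eq_sym tn0.
  rewrite -scalerN => Kb; apply: (alpha_perturbed_epi al (a := b)); last first.
    by rewrite -(scalerK tn0 (- b)); apply: cone_intZ; rewrite ?invr_gt0.
  move: tru; have [->|rn0] := eqVneq r 0.
    rewrite scale0r addr0 => /eqP; rewrite scaler_eq0 (negbTE tn0) => /eqP z0.
    by rewrite -z0.
  have {}r0 : 0 < r by rewrite lt_neqAle eq_sym rn0.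
  move=> /eqP; rewrite addr_eq0 => /eqP tz; apply: (AS _ z) => //.
  rewrite -(scalerK tn0 z) tz -scalerN.
  by apply: (SZ) => //; [rewrite invr_gt0|exact: SZ].
exists g.
  (* Continuity: [g <= 0] on [-S], which is a neighborhood of [- s]. *)
  split=> //; move: sint; rewrite /interior /= => /nbhs0_shift sint.
  apply: (@scalar_continuous R Z g V (- s) 0) => //.
  apply/nbhs0_shift; apply: filterS (nbhs0_oppr sint) => u /=.
  by rewrite /V /= opprD opprK.
by move=> u Su; rewrite -oppr_le0 -linearN; apply: gV; rewrite /V /= opprK.
Qed.

(** The [x] behind [A (yh, z)] may vary with [z]; conditions (3) and (4) do not provide a single
    one. *)
Definition bounded_above_near0 := exists yh V, nbhs 0 V /\
  forall z, V z -> Z0 z -> A (yh, z).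

(** With [c *: k0] above [yh], the cost [c] on [V] dominates [yh]. When [t *: z + r *: u = 0], the
    points [(b, z)] and [(yh, u)] of [A] combine to a point over 0, where [(alpha)] applies. *)
Lemma separator_of_bounded : bounded_above_near0 -> cond_alpha K Phi L y ->
  exists g, separator g.
Proof.
move=> [yh [V' [/nbhs0_convex[V [V0 Vcvx VN VV']] V'A]]] al.
have VA z : V z -> Z0 z -> A (yh, z) by move=> /VV'; exact: V'A.
have [c c0 Kc] := cone_dominates K_cone k0_int yh.
have V00 := nbhs_singleton V0.
have Ah : A (yh, 0) by apply: VA => //; exact: lin_hull_self.
have [||||g gA gV] :=
  @scalar_separation R Y K K_cone K_closed k0 k0_int Z A V c
    perturbed_epi_convex _ Vcvx.
- by exists (yh, 0).
- by exists 0.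
- move=> z; have [d d0 /(_ d)] := nbhs_ray z V0.
  rewrite gtr0_norm// add0r => /(_ (lexx _)) Vd.
  exists 0, d^-1, (yh, 0), (d *: z); split => //; first by rewrite invr_ge0 ltW.
  by rewrite scale0r add0r scalerA mulVf ?scale1r// gt_eqF.
- move=> t r [b z] u t0 r0 Abz Vu /= tru Kb.
  have [r0E|rn0] := eqVneq r 0.
    move: tru Kb; rewrite r0E mul0r !scale0r !addr0.
    have [->|tn0] := eqVneq t 0.
      by rewrite !scale0r oppr0 => _; exact: cone_int0.
    have {}t0 : 0 < t by rewrite lt_neqAle eq_sym tn0.
    move=> /eqP; rewrite scaler_eq0 (negbTE tn0) => /eqP z0.
    rewrite -scalerN => Kb; apply: (alpha_perturbed_epi al (a := b)).
      by rewrite -z0.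
    by rewrite -(scalerK tn0 (- b)); apply: cone_intZ; rewrite ?invr_gt0.
  have {}r0 : 0 < r by rewrite lt_neqAle eq_sym rn0.
  (* [V] is a neighborhood in all of [Z], but a [u] that cancels a multiple of a point of the domain
     lies in [Z0]. *)
  have Z0u : Z0 u.
    move: tru => /eqP; rewrite addrC addr_eq0 => /eqP ru.
    rewrite -(scalerK rn0 u) ru -scaleNr; do 2 apply: lin_hullZ.
    exact/lin_hull_self/(perturbed_epi_dom Abz).
  have [[b' z'] Ab' bE] := convex_set_combine perturbed_epi_convex t0 (ltW r0)
    Abz (VA _ Vu Z0u).
  have tr0 : 0 < t + r by rewrite ltr_wpDl.
  have /= := congr1 snd bE; rewrite /= tru => /esym/eqP.
  rewrite scaler_eq0 gt_eqF//= => /eqP z'0.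
  have /= b'E := congr1 fst bE.
  apply: (alpha_perturbed_epi al (a := b')); first by rewrite -z'0.
  rewrite -(scalerK (lt0r_neq0 tr0) (- b')); apply: cone_intZ; rewrite ?invr_gt0//.
  rewrite scalerN -b'E.
  have -> : - (t *: b + r *: yh) = - (t *: b + (r * c) *: k0) + r *: (c *: k0 - yh).
    by rewrite scalerBr scalerA !opprD addrA addrNK.
  by apply: cone_intD => //; exact: coneZ.
by exists g; split=> //; exact: (scalar_continuous V0 gV).
Qed.

(** * Conditions (1) to (4) bound [A] near 0 *)

Lemma bounded_of_majorant xh yh V : nbhs 0 V ->
  (forall z, V z -> Z0 z -> leK K (Phi (xh, z)) yh%:E) -> bounded_above_near0.
Proof.
move=> V0 Vle; exists (yh - L xh + y), V; split=> // z Vz Zz.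
exists xh, yh; split=> //.
have := @Phi_Yinf (xh, z); have := Vle z Vz Zz.
case Pa: (Phi (xh, z)) => [a| |]//= [k Kk kE] _.
by apply/(epiKP _ Pa); rewrite -opprB -kE opprK.
Qed.

Lemma bounded_of_continuous (xh : X) (yh : Y) :
  (forall V : set Y, nbhs yh V -> exists N : set Z, nbhs 0 N /\
    forall z, N z -> Z0 z -> (EFin @` V) (Phi (xh, z))) ->
  bounded_above_near0.
Proof.
move=> Pc; have [|N [N0 NP]] := Pc [set w | K (yh + k0 - w)].
  apply/nbhs0_shift; have /nbhs0_shift := k0_int.
  move=> /nbhs0_oppr; apply: filterS => w /=.
  by rewrite opprD addrA [yh + k0]addrC addrK.
apply: (@bounded_of_majorant xh (yh + k0) N) => // z Nz Zz.
have [w Kw <-] := NP z Nz Zz.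
by exists (yh + k0 - w) => //; rewrite opprB.
Qed.

(** Values over the finitely many points [0] and plus or minus [M^-1 *: b i] can be raised to
    multiples of [k0], which are totally ordered and so have a common bound; convexity of [A]
    spreads it to a neighborhood. *)
Lemma bounded_of_finite_dim : hausdorff_space Z ->
  finite_dim Z0 -> rel_interior pidom 0 -> bounded_above_near0.
Proof.
move=> hZ /(finite_dim_convex_nbhs hZ)[n [b [Zb nbhsP]]] [_ pint].
have ray i : exists d : R, 0 < d /\ forall l, `|l| <= d -> pidom (l *: b i).
  have [d d0 dP] := nbhs_ray (b i) pint; exists d; split=> // l ld.
  have := dP l ld; rewrite /= add0r; apply.
  by apply/aff_hull_lin/lin_hullZ/Zb.
have [d dP] := choice ray.
have [M M0 dM] := finite_upper_bound (fun i => (d i)^-1).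
have MdP i l : `|l| <= M^-1 -> pidom (l *: b i).
  have [d0 +] := dP i; move=> + lM; apply; apply: le_trans lM _.
  by rewrite invf_ple ?posrE//; exact: dM.
have KA z a : A (a, z) -> exists r, forall r', r <= r' -> A (r' *: k0, z).
  move=> Aa; have [r _ Kr] := cone_dominates K_cone k0_int a; exists r => r' rr'.
  have -> : r' *: k0 = a + ((r *: k0 - a) + (r' - r) *: k0).
    by rewrite addrA [a + _]addrC subrK scalerBl addrC subrK.
  apply: perturbed_epi_up => //; apply: coneD => //.
  move: rr'; rewrite -subr_ge0 le_eqVlt => /predU1P[<-|r0]; first by rewrite scale0r.
  by apply: coneZ => //; exact: nbhs_singleton.
have rP z : exists r, pidom z -> forall r', r <= r' -> A (r' *: k0, z).
  have [/pidom_perturbed_epi[a /KA[r rA]]|nz] := pselect (pidom z).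
    by exists r.
  by exists 0.
have [r {}rP] := choice rP.
have [M1 _ M1r] := finite_upper_bound (fun i => r (M^-1 *: b i)).
have [M2 _ M2r] := finite_upper_bound (fun i => r (- M^-1 *: b i)).
pose rh := Num.max (r 0) (Num.max M1 M2).
(* This implication is [within Z0] unfolded; the convex set passed to [nbhsP] is that of all [z]
   with [A (rh *: k0, z)]. *)
exists (rh *: k0), [set z | Z0 z -> A (rh *: k0, z)]; split; last by move=> z; exact.
have Mi0 : 0 < M^-1 by rewrite invr_gt0.
apply: (nbhsP M^-1) => //.
- apply/convex_setP => s t z z' s0 t0 st1 Az Az'.
  have := (convex_setP _).1 perturbed_epi_convex s t _ _ s0 t0 st1 Az Az'.
  congr (A _); apply: injective_projections => //=.
  by rewrite -scalerDl st1 scale1r.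
- by apply: rP => //; rewrite /rh le_max lexx.
- move=> i; split; apply: rP.
  + by apply: MdP; rewrite gtr0_norm.
  + by rewrite /rh !le_max M1r orbT.
  + by apply: MdP; rewrite normrN gtr0_norm.
  + by rewrite /rh !le_max M2r !orbT.
Qed.

(** Translate the epigraph so that its point [(x0, 0, w0)] becomes the origin, read it as a closed
    convex relation [G] between [X * Y] and [Z], and apply the open mapping theorem. *)
Lemma bounded_of_epi_closed :
  complete_tvs X -> first_countable X -> complete_tvs Y -> first_countable Y ->
  barreled_subspace Z0 -> K_epi_closed K Phi -> icr pidom 0 ->
  bounded_above_near0.
Proof.
move=> Xcpl Xfc Ycpl Yfc Z0bar Phicl Phiicr.
have [[x0 z0] x0d /= z00] := Phi_dom; rewrite {}z00 in x0d.
have [w0 Pw0] := dom_fin x0d.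
pose tau (p : X * Y * Z) : X * Z * Y := ((x0 + p.1.1, p.2), w0 + p.1.2).
have tauc : continuous tau.
  have fstc : continuous (fun p : X * Y * Z => x0 + p.1.1).
    move=> p; apply: (@continuous_comp _ _ _ (fun p : X * Y * Z => p.1.1)).
      by apply: (@continuous_comp _ _ _ fst fst); exact: cvg_fst.
    exact: continuous_translate.
  have sndc : continuous (fun p : X * Y * Z => w0 + p.1.2).
    move=> p; apply: (@continuous_comp _ _ _ (fun p : X * Y * Z => p.1.2)).
      by apply: (@continuous_comp _ _ _ fst snd); [exact: cvg_fst|exact: cvg_snd].
    exact: continuous_translate.
  apply: continuous_pair => //; apply: continuous_pair => // p.
  exact: cvg_snd.
pose G := tau @^-1` epiK K Phi.
(* Half of [k0] bounds [w] and half bounds [- L x] on [N]; together they keep [w - L x] below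
   [k0]. *)
pose k1 := 2^-1 *: k0.
have k1int : K° k1 by apply: cone_intZ => //; rewrite invr_gt0.
pose nuX (e : X * Y) := k1 + L e.1.
pose nuY (e : X * Y) := k1 + - e.2.
have nuXc : continuous nuX.
  move=> e; apply: (@continuous_comp _ _ _ (fun e : X * Y => L e.1)
    (fun w => k1 + w)).
    by apply: (@continuous_comp _ _ _ fst L); [exact: cvg_fst|exact: L_cont].
  exact: continuous_translate.
have nuYc : continuous nuY.
  move=> e; apply: (@continuous_comp _ _ _ (fun e : X * Y => - e.2)
    (fun w => k1 + w)).
    apply: (@continuous_comp _ _ _ snd -%R); first exact: cvg_snd.
    exact: opp_continuous.
  exact: continuous_translate.
pose N := nuX @^-1` K `&` nuY @^-1` K.
have /convex_setP Kcvx := K_cone.1.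
exists (w0 - L x0 + y + k0), [set z | Z0 z -> exists2 e, N e & G (e, z)]; split.
  apply: (@closed_convex_relation_open R (X * Y)%type Z G Z0 N) => //.
  - apply/convex_setP => s t p q s0 t0 st1 Gp Gq; rewrite /G /=.
    have -> : tau (s *: p + t *: q) = s *: tau p + t *: tau q.
      have E (V : lmodType R) (v u u' : V) :
          v + (s *: u + t *: u') = s *: (v + u) + t *: (v + u').
        by rewrite !scalerDr addrACA -scalerDl st1 scale1r.
      apply: injective_projections; last exact: E.
      by apply: injective_projections; first exact: E.
    exact: (convex_setP _).1.
  - by apply: closed_comp => // p _; exact: tauc.
  - by rewrite /G /= /tau /= !addr0; apply/(epiKP _ Pw0); rewrite subrr.
  - by move=> s t u v; exact: lin_hull_combine.
  - move=> e z /epiK_dom ed; apply: lin_hull_self.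
    by exists (x0 + e.1, z).
  - move=> z /(aff_hull_lin Phi_dom)/Phiicr[d d0 /(_ d)].
    rewrite lexx ltW// add0r => /(_ isT)[[x z'] xd /= xz].
    rewrite {}xz in xd; have [w Pw] := dom_fin xd.
    exists d => //; exists (x - x0, w - w0).
    rewrite /G /= /tau /= ![_ + (_ - _)]addrC !subrK.
    by apply/(epiKP _ Pw); rewrite subrr.
  - by apply: sequentially_complete_prod; exact: complete_sequentially.
  - exact: first_countable_prod.
  - apply: filterI; [apply: nuXc|apply: nuYc]; rewrite /nuX /nuY /=.
      by rewrite linear0 addr0.
    by rewrite subr0.
  - apply/convex_setP => s t e e' s0 t0 st1 [Xe Ye] [Xe' Ye']; split.
      have := Kcvx s t _ _ s0 t0 st1 Xe Xe'; congr K.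
      have LE : L (s *: e.1 + t *: e'.1) = s *: L e.1 + t *: L e'.1.
        by rewrite linearD !linearZ.
      by rewrite /nuX /= LE !scalerDr addrACA -scalerDl st1 scale1r.
    have := Kcvx s t _ _ s0 t0 st1 Ye Ye'; congr K.
    by rewrite /nuY /= !scalerDr addrACA -scalerDl st1 scale1r !scalerN opprD.
  - by apply: closedI; apply: closed_comp.
move=> z /[apply] -[[x w] [Kx Kw] Gz].
have k0E : k0 = k1 + k1.
  by rewrite -scalerDl -[k0 in LHS]scale1r [X in X *: _]splitr mul1r.
have E p q r a b k :
    p - q + r + (k + k) = (p + a - (q + b) + r) + ((k + b) + (k - a)) :> Y.
  rewrite (opprD q b) (addrACA p a) (addrAC (p - q) (a - b)) (addrACA k b).
  by rewrite (addrACA (p - q + r)) -(opprB a b) subrr addr0.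
have -> : w0 - L x0 + y + k0 =
    (w0 + w - L (x0 + x) + y) + (nuX (x, w) + nuY (x, w)).
  by rewrite k0E linearD; exact: E.
apply: perturbed_epi_up; last exact: coneD.
by exists (x0 + x), (w0 + w).
Qed.

(** * Condition (5) and the sign of a separator on [S] *)

(** Every point [(a, z)] of [A] can be moved to [(a, 0)], so [(alpha)] itself says that the zero
    form separates. *)
Lemma separator_of_monotone :
  (forall x z, dom Phi (x, z) -> leK K (Phi (x, 0)) (Phi (x, z))) ->
  cond_alpha K Phi L y -> separator (\0 : {scalar Z}).
Proof.
move=> Phile al; split; first by move=> z; exact: cvg_cst.
move=> [a z] [x [w [exw /= aE]]]; rewrite scale0r add0r.
apply: (alpha_perturbed_epi al); exists x, w; split=> //=.
by apply: (epiK_le exw); apply: Phile; exact: epiK_dom exw.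
Qed.

Lemma separator_ge0 (g : {scalar Z}) :
  (exists2 xt, dom Phi (xt, 0) &
    forall z, S (- z) -> leK K (Phi (xt, z)) (Phi (xt, 0))) ->
  separator g -> forall s, S s -> 0 <= g s.
Proof.
move=> [xt /dom_fin[a Pa] Phile] [_ gA] s Ss; rewrite leNgt; apply/negP => gs.
have [r r0 Kr] := cone_dominates K_cone k0_int (a - L xt + y).
(* Chosen so that [g (- (t *: s)) = r + 1]: [r *: k0] already dominates the value at [(xt, 0)], and
   the extra [k0] makes the difference interior. *)
pose t := (r + 1) / - g s.
have t0 : 0 < t by rewrite divr_gt0 ?oppr_gt0// addr_gt0.
apply: (gA (a - L xt + y, - (t *: s))).
  exists xt, a; split=> //=; apply: (@epiK_le (xt, 0)).
    by apply/(epiKP _ Pa); rewrite subrr.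
  by apply: Phile; rewrite opprK; case: S_cone => _; exact.
rewrite /= linearN linearZ /= -mulrN divfK ?oppr_eq0 ?lt_eqF//.
by rewrite scalerDl scale1r addrAC addrC; exact: cone_intD.
Qed.

End perturbation.

(** * The equivalences under each set of conditions *)

Theorem theorem3p6 (R : realType) (X Y Z : tvsType R)
  (hX : hausdorff_space X) (hY : hausdorff_space Y) (hZ : hausdorff_space Z)
  (K : set Y) (K_cone : convex_cone K) (K_closed : closed K)
  (K_proper : K <> [set: Y]) (K_int : K° !=set0)
  (S : set Z) (S_cone : convex_cone S) (S_nonempty : S !=set0)
  (Phi : X * Z -> \bar Y) (Phi_Yinf : forall p, Phi p <> -oo%E)
  (Phi_convex : K_convex K Phi)
  (Phi_dom : (snd @` dom Phi) 0) :
  let pidom : set Z := snd @` dom Phi in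
  let Z0 : set Z := lin_hull pidom in
  let alpha_iff_beta := forall (L : {linear X -> Y}) (y : Y),
    cont_linear L -> (cond_alpha K Phi L y <-> cond_beta K Phi L y) in
  let alpha_iff_gamma := forall (L : {linear X -> Y}) (y : Y),
    cont_linear L -> (cond_alpha K Phi L y <-> cond_gamma K S Phi L y) in
  ((exists z s : Z, [/\ pidom z, S° s & 0 = z - s]) ->
   (forall x z, dom Phi (x, z) -> S z -> leK K (Phi (x, 0)) (Phi (x, z))) ->
   alpha_iff_beta /\ alpha_iff_gamma)
  /\
  ((exists (xh : X) (yh : Y) (V : set Z), nbhs 0 V /\
      forall z, V z -> Z0 z -> leK K (Phi (xh, z)) yh%:E) \/
   (exists (xh : X) (yh : Y), Phi (xh, 0) = yh%:E /\
      forall V : set Y, nbhs yh V -> exists N : set Z, nbhs 0 N /\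
        forall z, N z -> Z0 z -> (EFin @` V) (Phi (xh, z))) \/
   (finite_dim Z0 /\ rel_interior pidom 0) \/
   [/\ complete_tvs X /\ first_countable X,
       complete_tvs Y /\ first_countable Y,
       barreled_subspace Z0, K_epi_closed K Phi & icr pidom 0] \/
   ((forall x z, dom Phi (x, z) -> leK K (Phi (x, 0)) (Phi (x, z))) /\
    pidom° !=set0) ->
   alpha_iff_beta /\
   ((exists2 xt : X, dom Phi (xt, 0) &
       forall z, S (- z) -> leK K (Phi (xt, z)) (Phi (xt, 0))) ->
    alpha_iff_gamma)).
Proof.
move=> pidom Z0 alpha_iff_beta alpha_iff_gamma.
have [k0 k0_int] := K_int.
have beta_of_separator :
    (forall L y, cont_linear L -> cond_alpha K Phi L y ->
      exists g, separator K k0 Phi L y g) -> alpha_iff_beta.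
  move=> sepP L y Lc; split; last exact: beta_alpha.
  move=> /(sepP _ _ Lc)[g].
  exact: (separator_beta K_cone K_closed k0_int Phi_Yinf Lc).
have gamma_of_separator :
    (forall L y, cont_linear L -> cond_alpha K Phi L y ->
      exists2 g, separator K k0 Phi L y g & forall s, S s -> 0 <= g s) ->
    alpha_iff_gamma.
  move=> sepP L y Lc; split; last by move=> /gamma_beta; exact: beta_alpha.
  move=> /(sepP _ _ Lc)[g].
  exact: (separator_gamma K_cone K_closed k0_int Phi_Yinf Lc).
split=> [int_S Phi_le|cq].
  have sepP L y : cond_alpha K Phi L y ->
      exists2 g, separator K k0 Phi L y g & forall s, S s -> 0 <= g s.
    exact: (separator_of_interior_cone K_cone K_closed K_proper k0_int S_cone).
  split; first by apply: beta_of_separator => L y _ /sepP[g]; exists g.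
  by apply: gamma_of_separator => L y _; exact: sepP.
have sepP L y : cont_linear L -> cond_alpha K Phi L y ->
    exists g, separator K k0 Phi L y g.
  move=> Lc al; have bounded_sep : bounded_above_near0 K Phi L y ->
      exists g, separator K k0 Phi L y g.
    by move=> bnd; apply: (separator_of_bounded K_cone K_closed K_proper k0_int).
  move: cq => [[xh [yh [V [V0 Vle]]]]|[[xh [yh [_ Pc]]]|[[Zfin Zri]|
    [cl|[Phi_le _]]]]].
  - exact/bounded_sep/(bounded_of_majorant Phi_Yinf L y V0 Vle).
  - exact/bounded_sep/(bounded_of_continuous k0_int Phi_Yinf L y Pc).
  - apply: bounded_sep.
    exact: (bounded_of_finite_dim K_cone K_closed k0_int Phi_Yinf).
  - have [[Xcpl Xfc] [Ycpl Yfc] Zbar Phicl Zicr] := cl.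
    apply: bounded_sep.
    exact: (bounded_of_epi_closed K_cone K_closed k0_int Phi_Yinf).
  - by exists \0; exact: separator_of_monotone.
split; first exact: beta_of_separator.
move=> xt_le; apply: gamma_of_separator => L y Lc /(sepP _ _ Lc)[g sg].
exists g => // s.
exact: (separator_ge0 K_cone K_closed k0_int S_cone Phi_Yinf xt_le sg).
Qed.
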